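(* Let $(V,f)$ be a non-degenerate cubic space, and let $(W,g)$ be a cubic space of countable or finite dimension. Then $W$ embeds into $V$ if and only if $\mathrm{rrk}(W)\le \mathrm{rrk}(V)$ (as elements of $\mathbf{N}\cup\{\infty\}$).
   Context: Throughout, $k$ is an algebraically closed field of characteristic different from $2$ and $3$. For a $k$-vector space $V$ (of arbitrary dimension) with basis $\{v_i\}_{i\in I}$, let $x_i\in V^*$ be the dual coordinate functionals (''coordinates''). $P_n(V)$ denotes the space of degree-$n$ polynomial functions on $V$: every element of $P_n(V)$ is a unique formal, possibly infinite, $k$-linear combination of degree-$n$ monomials in the $x_i$, and can be evaluated at any $v\in V$. $P(V)=\bigoplus_{n\ge 0}P_n(V)$ is a graded ring. The strength $\mathrm{str}(f)$ of a homogeneous $f\in P_n(V)$, $n\ge 1$, is the least $s$ such that $f=\sum_{i=1}^s g_ih_i$ with $g_i,h_i$ homogeneous elements of $P(V)$ of positive degree less than $n$, and $\mathrm{str}(f)=\infty$ if no such expression exists. A cubic space is a pair $(V,f)$ with $f\in P_3(V)$; it is non-degenerate if $\mathrm{str}(f)=\infty$. An embedding $(W,g)\to(V,f)$ of cubic spaces is a $k$-linear map $\phi:W\to V$ with $f\circ\phi=g$. Let $P_2^\circ(V)\subset P_2(V)$ be the subspace of quadratic forms of finite strength and $\overline{P}_2(V)=P_2(V)/P_2^\circ(V)$. For $f\in P_3(V)$, the residual rank $\mathrm{rrk}(f)\in\mathbf{N}\cup\{\infty\}$ is the dimension of the subspace of $\overline{P}_2(V)$ spanned by the images of the formal partial derivatives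 $\partial f/\partial x_i$, $i\in I$ (computed termwise on monomials); this is independent of the basis. The residual rank of a cubic space $(V,f)$ is $\mathrm{rrk}(V)=\mathrm{rrk}(f)$. *)

(* Defs.v *)
From HB Require Import structures.
From mathcomp Require Import all_boot all_order all_algebra.
From mathcomp Require Import finmap multiset.
From Stdlib Require Import ClassicalEpsilon.

Set Implicit Arguments.
Unset Strict Implicit.
Unset Printing Implicit Defensive.

Import GRing.Theory.
Local Open Scope fset_scope.
Local Open Scope ring_scope.

Section CubicSpaces.
Variables (k : fieldType) (I : choiceType).

(* The vector space V with basis {v_i}_{i in I}: finitely supported
   coordinate functions I -> k (v = sum_i v i * v_i). *)
Definition vec := {fsfun I -> k with 0}.

Definition vlincomb (a : k) (u v : vec) : vec :=
  [fsfun x in finsupp u `|` finsupp v => a * u x + v x].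

(* Monomials in the coordinates x_i : finite multisets over I;
   the degree of m is size (enum_mset m), and m i is the exponent of x_i. *)
Definition mono := multiset I.
Definition mdeg (m : mono) : nat := size (enum_mset m).

(* Elements of P(V) (formal, possibly infinite, linear combinations of
   monomials), given by their coefficient functions. *)
Definition fpoly := mono -> k.

Definition homogp (n : nat) (f : fpoly) : Prop :=
  forall m : mono, f m != 0 -> mdeg m = n.

Definition submsets (m : mono) : seq mono :=
  undup [seq (seq_mset (mask (val t) (enum_mset m)) : mono)
        | t <- enum {: (mdeg m).-tuple bool}].

Definition mulp (g h : fpoly) : fpoly :=
  fun m => \sum_(m1 <- submsets m) g m1 * h (msetB m m1).

Definition strength_le (n : nat) (f : fpoly) (s : nat) : Prop :=
  exists (gs hs : 'I_s -> fpoly),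
    (forall i, exists a b : nat,
        [/\ (0 < a < n)%N, (0 < b < n)%N, homogp a (gs i) & homogp b (hs i)]) /\
    (forall m, f m = \sum_(i < s) mulp (gs i) (hs i) m).

Definition finite_strength (n : nat) (f : fpoly) : Prop :=
  exists s, strength_le n f s.

Definition cubic_nondeg (f : fpoly) : Prop := ~ finite_strength 3 f.

(* evaluation of f \in P_n(V) at v : only monomials supported in the
   support of v contribute *)
Definition evaln (n : nat) (f : fpoly) (v : vec) : k :=
  \sum_(m <- undup [seq (seq_mset (map val (val t)) : mono)
                   | t <- enum {: n.-tuple (finsupp v)}])
     f m * \prod_(i <- enum_mset m) v i.

Definition dpart (i : I) (f : fpoly) : fpoly :=
  fun m => (m i).+1%:R * f (msetD (msetn 1 i) m).

(* the images of df/dx_{ix j}, j < r, are linearly independent in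
   P_2(V)/P_2^o(V) *)
Definition rrk_ge (f : fpoly) (r : nat) : Prop :=
  exists ix : 'I_r -> I,
    forall c : 'I_r -> k,
      finite_strength 2 (fun m => \sum_(j < r) c j * dpart (ix j) f m) ->
      forall j, c j = 0.

(* the residual rank, as an element of N \cup {infinity}
   (None stands for infinity): the dimension of the span of the images *)
Definition is_rrk (f : fpoly) (d : option nat) : Prop :=
  match d with
  | Some r => rrk_ge f r /\ ~ rrk_ge f r.+1
  | None => forall r, rrk_ge f r
  end.

Definition rrk (f : fpoly) : option nat :=
  epsilon (inhabits None) (is_rrk f).

End CubicSpaces.

Definition le_ninf (a b : option nat) : bool :=
  match a, b with
  | _, None => true
  | None, Some _ => false
  | Some x, Some y => (x <= y)%N
  end.

Definition coord_linear (k : fieldType) (J I : choiceType)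
  (phi : vec k J -> vec k I) : Prop :=
  forall (a : k) (u v : vec k J) (i : I),
    phi (vlincomb a u v) i = a * phi u i + phi v i.

Definition cubic_embeds (k : fieldType) (J I : choiceType)
  (g : fpoly k J) (f : fpoly k I) : Prop :=
  exists phi : vec k J -> vec k I,
    coord_linear phi /\ forall w : vec k J, evaln 3 f (phi w) = evaln 3 g w.

(* Main.v *)
Require Import Defs.
From HB Require Import structures.
From mathcomp Require Import all_boot all_order all_algebra.
From mathcomp Require Import finmap multiset.
From mathcomp Require Import boolp classical_sets.
From mathcomp Require Import ring zify.
From Stdlib Require ClassicalEpsilon.

(** Let B be the symmetric trilinear form of f and K the space of vectors x for which
    the quadratic form B(x, -, -) vanishes on a subspace of finite codimension, that is,
    has finite strength: the residual rank is dim V/K.  An embedding pulls K back into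
    the kernel of the source, so it cannot decrease the residual rank.

    Conversely, non-degeneracy says that f is nonzero on every subspace of finite
    codimension.  The key step solves B(o_i, v, v) = tau_i, f(v) = c in any such
    subspace, as soon as every relation sum c_i o_i in K is satisfied by the tau_i.
    Values (B(o_i, v, v))_i at vectors orthogonal to everything chosen before add up,
    and they can be scaled by extracting square roots, so the values attained in this
    way form a linear space; being as large as possible, it contains tau.  An isotropic
    vector on which f is nonzero then adjusts the value of f.

    Iterating, V contains vectors A_n and E_q on which f is its restriction to the A_n
    plus prescribed multiples of A_(nu q) E_q^2 (where A_(nu q) is not in K) or E_q^3;
    by polarization, these become arbitrary products.  A cubic form in countably many
    variables t_n is a locally finite sum of such products: write it as
    sum_n t_n q_n(t_n, t_(n+1), ..), where q_n is a sum of products of t_m by linear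
    forms in t_m, t_(m+1), .., and only finitely many products are needed when q_n has
    finite rank. *)

Set Implicit Arguments.
Unset Strict Implicit.
Unset Printing Implicit Defensive.

Import GRing.Theory.
Local Open Scope classical_set_scope.
Local Open Scope ring_scope.

(** * Subspaces and independence *)

Lemma natr6_neq0 (k : fieldType) : 2%:R != 0 :> k -> 3%:R != 0 :> k -> 6%:R != 0 :> k.
Proof. by move=> two_neq0 three_neq0; rewrite (natrM _ 2 3) mulf_neq0. Qed.

Lemma linear_lincomb (k : fieldType) (V W : lmodType k) (phi : V -> W) (T : Type)
    (r : seq T) (c : T -> k) (x : T -> V) :
  linear phi -> phi (\sum_(i <- r) c i *: x i) = \sum_(i <- r) c i *: phi (x i).
Proof.
move=> lphi; elim: r => [|i r IH]; last by rewrite !big_cons lphi IH.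
by rewrite !big_nil -[0 in LHS]subr0 (zmod_morphism_linear lphi) subrr.
Qed.

Section Subspaces.
Variables (k : fieldType) (V : lmodType k).
Implicit Types (l : V -> k) (S K U : set V) (D E : seq V).

Lemma scalar0 l : scalar l -> l 0 = 0.
Proof. by move=> ll; rewrite -[0]subr0 (zmod_morphism_linear ll) subrr. Qed.

Lemma scalarD l u v : scalar l -> l (u + v) = l u + l v.
Proof. by move=> ll; rewrite -[u]scale1r ll mul1r scale1r. Qed.

Lemma scalar_sum l (T : Type) (r : seq T) (c : T -> k) (x : T -> V) :
  scalar l -> l (\sum_(i <- r) c i *: x i) = \sum_(i <- r) c i * l (x i).
Proof. exact: (@linear_lincomb _ _ k^o). Qed.

Definition subspace S := S 0 /\ forall a u v, S u -> S v -> S (a *: u + v).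

Lemma subspaceZ S a u : subspace S -> S u -> S (a *: u).
Proof. by case=> S0 SL Su; rewrite -[_ *: _]addr0; apply: SL. Qed.

Lemma subspaceD S u v : subspace S -> S u -> S v -> S (u + v).
Proof. by case=> S0 SL Su Sv; rewrite -[u]scale1r; apply: SL. Qed.

Lemma subspaceDZ S a u v : subspace S -> S u -> S v -> S (u + a *: v).
Proof. by move=> sS Su Sv; rewrite addrC; apply: sS.2. Qed.

Lemma subspaceB S u v : subspace S -> S u -> S v -> S (u - v).
Proof. by move=> sS Su Sv; rewrite addrC -scaleN1r; apply: sS.2. Qed.

Lemma subspace_lincomb S (T : eqType) (r : seq T) (c : T -> k) (x : T -> V) :
  subspace S -> (forall i, i \in r -> S (x i)) -> S (\sum_(i <- r) c i *: x i).
Proof.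
move=> sS Sx; rewrite big_seq; apply: (big_ind S) => [|u v|i ir].
- exact: sS.1.
- exact: subspaceD.
- by apply: subspaceZ => //; apply: Sx.
Qed.

Lemma subspace_ker l : scalar l -> subspace [set v | l v = 0].
Proof.
move=> ll; split=> [|a u v /= lu lv]; first exact: scalar0.
by rewrite ll lu lv mulr0 addr0.
Qed.

Lemma subspaceI S S' : subspace S -> subspace S' -> subspace (S `&` S').
Proof.
move=> [S0 SL] [S'0 S'L]; split=> // a u v [Su S'u] [Sv S'v].
by split; [apply: SL | apply: S'L].
Qed.

Definition lspan (A : set V) : set V := smallest subspace A.

Lemma lspan_subspace A : subspace (lspan A).
Proof.
split=> [S [[S0 _] _] //|a u v Au Av S [sS AS]].
by apply: sS.2; [apply: Au | apply: Av].
Qed.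

Lemma mem_lspan A x : A x -> lspan A x.
Proof. exact: sub_gen_smallest. Qed.

Lemma lspanS (A B : set V) : A `<=` B -> lspan A `<=` lspan B.
Proof. exact: sub_smallest2r (lspan_subspace _). Qed.

Definition span_mod K D := lspan (K `|` [set` D]).

Lemma mem_span_mod K D d : d \in D -> span_mod K D d.
Proof. by move=> dD; apply: mem_lspan; right. Qed.

Lemma sub_span_mod K D : K `<=` span_mod K D.
Proof. by move=> x Kx; apply: mem_lspan; left. Qed.

Lemma span_modS K D D' : {subset D <= D'} -> span_mod K D `<=` span_mod K D'.
Proof. by move=> DD'; apply: lspanS; apply: setUS => x; apply: DD'. Qed.

Lemma span_mod_coord K D v : subspace K -> span_mod K D v ->
  exists c : nat -> k, K (v - \sum_(i < size D) c i *: D`_i).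
Proof.
move=> sK.
pose combs := [set v | exists c : nat -> k, K (v - \sum_(i < size D) c i *: D`_i)].
suff: span_mod K D `<=` combs by apply.
apply: smallest_sub.
  split=> [|a u w [c Kc] [c' Kc']].
    exists (fun=> 0); rewrite big1 ?subrr => [|i _]; last by rewrite scale0r.
    exact: sK.1.
  exists (fun i => a * c i + c' i); under eq_bigr => i _ do rewrite scalerDl -scalerA.
  rewrite big_split /= -scaler_sumr opprD addrACA -scalerBr.
  exact: sK.2.
move=> x [Kx|/= Dx].
  by exists (fun=> 0); rewrite big1 ?subr0 // => i _; rewrite scale0r.
have ltx : (index x D < size D)%N by rewrite index_mem.
exists (fun i => (i == index x D)%:R).
rewrite (bigD1 (Ordinal ltx)) //= eqxx scale1r nth_index // big1 ?addr0 ?subrr.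
  exact: sK.1.
by move=> i; rewrite -val_eqE /= => /negPf->; rewrite scale0r.
Qed.

Definition independent_mod K D := forall c : nat -> k,
  K (\sum_(i < size D) c i *: D`_i) -> forall i, (i < size D)%N -> c i = 0.

Lemma independent_mod_nil K : independent_mod K [::].
Proof. by []. Qed.

Lemma independent_mod_rcons K D v :
  independent_mod K D -> ~ span_mod K D v -> independent_mod K (rcons D v).
Proof.
move=> iD Dv c; rewrite size_rcons big_ord_recr /= nth_rcons ltnn eqxx.
under eq_bigr => i _ do rewrite nth_rcons ltn_ord.
move=> Kc; have [c0|cn0] := eqVneq (c (size D)) 0.
  move: Kc; rewrite c0 scale0r addr0 => /iD ci i; rewrite ltnS leq_eqVlt.
  by case/predU1P=> [->//|/ci].
case: Dv; have sS : subspace (span_mod K D) := lspan_subspace _.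
rewrite -[v]scale1r -(mulVf cn0) -scalerA; apply: (subspaceZ _ sS).
rewrite -[_ *: v](addKr (\sum_(i < size D) c i *: D`_i)) addrC.
apply: (subspaceB sS); first exact: sub_span_mod.
by apply: (subspace_lincomb _ sS) => i _; apply: mem_span_mod; apply: mem_nth.
Qed.

Lemma independent_mod_leq K D E : subspace K -> independent_mod K E ->
  {in E, forall x, span_mod K D x} -> (size E <= size D)%N.
Proof.
move=> sK iE DE; rewrite leqNgt; apply/negP => ltDE.
have /choice[a Ka] : forall j : 'I_(size E), exists c : nat -> k,
    K (E`_j - \sum_(i < size D) c i *: D`_i).
  by move=> j; apply: span_mod_coord sK _; apply: DE; apply: mem_nth.
pose M := \matrix_(j < size E, i < size D) a j i.
have : kermx M != 0.
  by rewrite -mxrank_eq0 mxrank_ker -lt0n subn_gt0 (leq_ltn_trans (rank_leq_col _)).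
case/matrix0Pn=> r [j nz]; case/negP: nz; apply/eqP.
pose c n := if insub n is Some i then kermx M r i else 0.
have cE (i : 'I_(size E)) : c i = kermx M r i by rewrite /c valK.
rewrite -cE; apply: iE => //.
have -> : \sum_(i < size E) c i *: E`_i =
    \sum_(i < size E) c i *: (E`_i - \sum_(l < size D) a i l *: D`_l).
  under [RHS]eq_bigr => i _ do rewrite scalerBr scaler_sumr.
  rewrite sumrB exchange_big [X in _ - X]big1 ?subr0 // => l _.
  under eq_bigr => i _ do rewrite scalerA.
  rewrite -scaler_suml [X in X *: _](_ : _ = (kermx M *m M) r l).
    by rewrite mulmx_ker mxE scale0r.
  by rewrite mxE; apply: eq_bigr => i _; rewrite cE [M _ _]mxE.
exact: subspace_lincomb.
Qed.

End Subspaces.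

Section FiniteCodimension.
Variables (k : fieldType) (V : lmodType k).
Implicit Types (l : V -> k) (K U : set V) (D : seq V).

Inductive finite_codim : set V -> Prop :=
| finite_codimT : finite_codim setT
| finite_codim_cut U l :
    finite_codim U -> scalar l -> finite_codim (U `&` [set v | l v = 0]).

Lemma finite_codim_subspace U : finite_codim U -> subspace U.
Proof.
by elim=> {U} [//|U l _ sU ll]; apply: subspaceI => //; apply: subspace_ker.
Qed.

Lemma finite_codim_ker l : scalar l -> finite_codim [set v | l v = 0].
Proof.
by move=> ll; rewrite -[X in finite_codim X]setTI; apply: finite_codim_cut finite_codimT ll.
Qed.

Lemma finite_codimI U U' : finite_codim U -> finite_codim U' -> finite_codim (U `&` U').
Proof.
move=> cU; elim=> [|{}U' l _ IH ll]; first by rewrite setIT.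
by rewrite setIA; apply: finite_codim_cut.
Qed.

Lemma finite_codim_bigcap (T : choiceType) (r : seq T) (U : T -> set V) :
  (forall t, t \in r -> finite_codim (U t)) -> finite_codim (\bigcap_(t in [set` r]) U t).
Proof.
move=> cU; rewrite bigcap_seq big_seq; apply: big_ind => //; first exact: finite_codimT.
exact: finite_codimI.
Qed.

(* The successive hyperplanes can be taken transverse to what was cut out before. *)
Lemma finite_codim_proper_ind (P : set V -> Prop) : P setT ->
  (forall U l x, finite_codim U -> P U -> scalar l -> U x -> l x = 1 ->
    P (U `&` [set v | l v = 0])) ->
  forall U, finite_codim U -> P U.
Proof.
move=> PT Pcut U; elim=> {U} [//|U l cU PU ll].
have [Ul|] := pselect (U `<=` [set v | l v = 0]); first by rewrite setIidl.
move/existsNP=> [x /not_implyP[Ux /eqP lx]].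
apply: (Pcut U l ((l x)^-1 *: x)) => //.
  by apply: subspaceZ => //; apply: finite_codim_subspace.
by rewrite (scalable_linear ll) /= mulVf.
Qed.

Lemma finite_codim_basis K D : subspace K -> independent_mod K D ->
  (forall v, span_mod K D v) -> finite_codim K.
Proof.
move=> sK iD DV; have /choice[c cE] v := span_mod_coord sK (DV v).
have c_scalar n : (n < size D)%N -> scalar (c^~ n).
  move=> nD a u v; apply/eqP; rewrite -subr_eq0; apply/eqP.
  apply: (iD (fun n => c (a *: u + v) n - (a * c u n + c v n))) nD.
  under eq_bigr => i _ do rewrite scalerBl scalerDl -scalerA.
  rewrite sumrB big_split /= -scaler_sumr.
  have subBB (x y z : V) : x - y - (x - z) = z - y by rewrite opprB addrC addrA subrK.
  have := subspaceB sK (sK.2 a _ _ (cE u) (cE v)) (cE (a *: u + v)).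
  by rewrite scalerBr addrACA -opprD subBB.
rewrite [K](_ : _ = \bigcap_(n in [set` iota 0 (size D)]) [set v | c v n = 0]).
  apply: finite_codim_bigcap => n; rewrite mem_iota => nD; apply: finite_codim_ker.
  exact: c_scalar.
apply/seteqP; split=> v Kv.
  move=> n; rewrite /= mem_iota => nD; apply: (iD (c v)) nD.
  by have := subspaceB sK Kv (cE v); rewrite subKr.
have := cE v; rewrite big1 ?subr0 // => i _.
by rewrite (Kv i) ?scale0r //= mem_iota ltn_ord.
Qed.

Lemma linear_hyperplane_proj l x : scalar l -> linear (fun v => v - l v *: x).
Proof.
by move=> ll a u v; rewrite ll scalerDl -scalerA scalerBr opprD addrACA.
Qed.

Lemma mem_hyperplane_proj U l x v : subspace U -> scalar l -> U x -> l x = 1 ->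
  U v -> (U `&` [set v | l v = 0]) (v - l v *: x).
Proof.
move=> sU ll Ux lx Uv; rewrite -scaleNr; split; first exact: subspaceDZ.
by rewrite /= addrC ll lx mulr1 addNr.
Qed.

Definition infinite_codim K := forall D, exists v, ~ span_mod K D v.

Lemma infinite_codim_escape K U D : infinite_codim K -> finite_codim U ->
  exists2 w, U w & ~ span_mod K D w.
Proof.
move=> iK cU; elim/finite_codim_proper_ind: cU D => {U} [D|U l x cU IH ll Ux lx D].
  by have [v Dv] := iK D; exists v.
have [w Uw Dw] := IH (x :: D).
exists (w - l w *: x).
  exact: mem_hyperplane_proj (finite_codim_subspace cU) ll Ux lx Uw.
have sS : subspace (span_mod K (x :: D)) := lspan_subspace _.
move=> Dw'; apply: Dw; rewrite -(subrK (l w *: x) w); apply: subspaceDZ sS _ _.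
  by apply: span_modS Dw' => d dD; rewrite inE dD orbT.
by apply: mem_span_mod; rewrite mem_head.
Qed.

Definition vanishes_cofinitely (F : V -> k) :=
  exists2 U, finite_codim U & forall v, U v -> F v = 0.

Lemma not_vanishes_cofinitely F U : ~ vanishes_cofinitely F -> finite_codim U ->
  exists2 v, U v & F v != 0.
Proof.
move=> nF cU; apply: contrapT => noU; apply: nF; exists U => // v Uv.
by apply/eqP/negPn/negP => nz; apply: noU; exists v.
Qed.

End FiniteCodimension.

Lemma finite_codim_preimage (k : fieldType) (V W : lmodType k) (phi : W -> V) U :
  linear phi -> finite_codim U -> finite_codim (phi @^-1` U).
Proof.
move=> lphi; elim=> {U} [|U l _ IH ll].
  by rewrite preimage_setT; apply: finite_codimT.
rewrite preimage_setI; apply: (@finite_codim_cut _ _ _ (l \o phi)) => // a u v /=.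
by rewrite lphi ll.
Qed.

(** * Symmetric multilinear forms *)

Section SymmetricForms.
Variables (k : fieldType) (V : lmodType k).

Definition symmetric_bilinear (Q : V -> V -> k) :=
  (forall v, scalar (Q^~ v)) /\ forall u v, Q u v = Q v u.

Definition symmetric_trilinear (B : V -> V -> V -> k) :=
  [/\ forall v w, scalar (fun u => B u v w), forall u v w, B u v w = B v u w
    & forall u v w, B u v w = B u w v].

Section Trilinear.
Variables (B : V -> V -> V -> k) (tB : symmetric_trilinear B).
Implicit Types (D : seq V) (o u v w x y : V).

Lemma triC12 u v w : B u v w = B v u w. Proof. by case: tB. Qed.
Lemma triC23 u v w : B u v w = B u w v. Proof. by case: tB. Qed.
Lemma triC13 u v w : B u v w = B w v u.
Proof. by rewrite triC12 triC23 triC12. Qed.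

Lemma tri_scalar1 x y : scalar (fun u => B u x y). Proof. by case: tB. Qed.
Lemma tri_scalar2 x y : scalar (fun u => B x u y).
Proof. by move=> a u v; rewrite !(triC12 x); apply: tri_scalar1. Qed.
Lemma tri_scalar3 x y : scalar (fun u => B x y u).
Proof. by move=> a u v; rewrite !(triC13 x); apply: tri_scalar1. Qed.

Lemma triD1 u v x y : B (u + v) x y = B u x y + B v x y.
Proof. exact: scalarD (tri_scalar1 x y). Qed.
Lemma triD2 u v x y : B x (u + v) y = B x u y + B x v y.
Proof. exact: scalarD (tri_scalar2 x y). Qed.
Lemma triD3 u v x y : B x y (u + v) = B x y u + B x y v.
Proof. exact: scalarD (tri_scalar3 x y). Qed.

Lemma triZ1 a u x y : B (a *: u) x y = a * B u x y.
Proof. exact: (scalable_linear (tri_scalar1 x y)). Qed.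
Lemma triZ2 a u x y : B x (a *: u) y = a * B x u y.
Proof. exact: (scalable_linear (tri_scalar2 x y)). Qed.
Lemma triZ3 a u x y : B x y (a *: u) = a * B x y u.
Proof. exact: (scalable_linear (tri_scalar3 x y)). Qed.

Lemma symmetric_bilinear_tri x : symmetric_bilinear (B x).
Proof. by split=> [v|u v]; [exact: tri_scalar2 | exact: triC23]. Qed.

Lemma quadD o u v :
  B o (u + v) (u + v) = B o u u + 2%:R * B o u v + B o v v.
Proof. by rewrite !(triD2, triD3) (triC23 o v u); ring. Qed.

Lemma cubeD u v : B (u + v) (u + v) (u + v) =
  B u u u + 3%:R * B u u v + 3%:R * B u v v + B v v v.
Proof.
by rewrite triD1 !quadD (triC12 v u v) (triC13 v u u); ring.
Qed.

Lemma cube_polarization u v w : 6%:R * B u v w =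
  B (u + v + w) (u + v + w) (u + v + w) - B (u + v) (u + v) (u + v)
  - B (u + w) (u + w) (u + w) - B (v + w) (v + w) (v + w)
  + B u u u + B v v v + B w w w.
Proof.
rewrite !(triD1, triD2, triD3) !(triC23 _ v u) !(triC23 _ w u) !(triC23 _ w v).
rewrite !(triC12 v u) !(triC12 w u) !(triC12 w v).
by rewrite !(triC23 _ v u) !(triC23 _ w u) !(triC23 _ w v); ring.
Qed.

Definition residual_kernel : set V :=
  [set x | vanishes_cofinitely (fun v => B x v v)].

Lemma residual_kernel_subspace : subspace residual_kernel.
Proof.
split=> [|a u v [U cU U0] [U' cU' U'0]].
  by exists setT => [|v _]; [exact: finite_codimT | exact: scalar0 (tri_scalar1 v v)].
exists (U `&` U') => [|x [Ux U'x]]; first exact: finite_codimI.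
by rewrite (tri_scalar1 x x) U0 // U'0 // mulr0 addr0.
Qed.

Definition tri_orth D : set V :=
  [set v | forall d d', d \in D -> d' \in D -> B d d' v = 0].

Lemma finite_codim_tri_orth D : finite_codim (tri_orth D).
Proof.
have -> : tri_orth D =
    \bigcap_(p in [set` [seq (d, d') | d <- D, d' <- D]]) [set v | B p.1 p.2 v = 0].
  apply/seteqP; split=> v Hv.
    by move=> _ /allpairsP[[d d'] /= [dD d'D ->]]; apply: Hv.
  by move=> d d' dD d'D; apply: (Hv (d, d')); apply/allpairsP; exists (d, d').
by apply: finite_codim_bigcap => p _; apply: finite_codim_ker; apply: tri_scalar3.
Qed.

Lemma tri_orthZ D a v : tri_orth D v -> tri_orth D (a *: v).
Proof. exact: subspaceZ (finite_codim_subspace (finite_codim_tri_orth D)). Qed.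

Lemma tri_orth_lspan D v a b :
  tri_orth D v -> lspan [set` D] a -> lspan [set` D] b -> B a b v = 0.
Proof.
move=> oD Da Db; apply: (Da [set a | B a b v = 0]); split.
  exact: subspace_ker (tri_scalar1 b v).
move=> d dD; apply: (Db [set b | B d b v = 0]); split.
  exact: subspace_ker (tri_scalar2 d v).
by move=> d' d'D; apply: oD.
Qed.

Lemma quadD_orth D o u v : tri_orth D v -> lspan [set` D] o -> lspan [set` D] u ->
  B o (u + v) (u + v) = B o u u + B o v v.
Proof. by move=> ov Do Du; rewrite quadD (tri_orth_lspan ov Do Du) mulr0 addr0. Qed.

Lemma cubeD_orth D u v : tri_orth D v -> lspan [set` D] u ->
  B (u + v) (u + v) (u + v) = B u u u + 3%:R * B u v v + B v v v.
Proof. by move=> ov Du; rewrite cubeD (tri_orth_lspan ov Du Du) mulr0 addr0. Qed.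

Lemma quadD_orthZ D o u v a : tri_orth D v -> lspan [set` D] o -> lspan [set` D] u ->
  B o (u + a *: v) (u + a *: v) = B o u u + a ^+ 2 * B o v v.
Proof.
by move=> /(tri_orthZ a) ov Do Du; rewrite (quadD_orth ov) // triZ2 triZ3 mulrA.
Qed.

Lemma cubeD_orthZ D u v a : tri_orth D v -> lspan [set` D] u ->
  B (u + a *: v) (u + a *: v) (u + a *: v) =
  B u u u + 3%:R * a ^+ 2 * B u v v + a ^+ 3 * B v v v.
Proof.
move=> /(tri_orthZ a) ov Du; rewrite (cubeD_orth ov Du) triZ1 !(triZ2, triZ3); ring.
Qed.

End Trilinear.

Lemma eq_symmetric_trilinear B B' : symmetric_trilinear B -> symmetric_trilinear B' ->
  6%:R != 0 :> k -> (forall v, B v v v = B' v v v) -> forall u v w, B u v w = B' u v w.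
Proof.
move=> tB tB' six_neq0 BB' u v w.
by apply: (mulfI six_neq0); rewrite !cube_polarization // !BB'.
Qed.

End SymmetricForms.

Section Composition.
Variables (k : fieldType) (V W : lmodType k) (phi : W -> V).
Hypothesis phi_lin : linear phi.

Lemma symmetric_bilinear_comp Q :
  symmetric_bilinear Q -> symmetric_bilinear (fun u v => Q (phi u) (phi v)).
Proof. by case=> Q1 Qs; split=> [v a u u'|u v]; rewrite ?phi_lin // Q1. Qed.

Lemma symmetric_trilinear_comp B :
  symmetric_trilinear B -> symmetric_trilinear (fun u v w => B (phi u) (phi v) (phi w)).
Proof.
case=> B1 B12 B23; split=> [v w a u u'|u v w|u v w] //; by rewrite phi_lin B1.
Qed.

End Composition.

Section FiniteRank.
Variables (k : fieldType) (V : lmodType k).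
Hypotheses (two_neq0 : 2%:R != 0 :> k) (three_neq0 : 3%:R != 0 :> k).

(* Cutting U by one more functional l with l x = 1 replaces Q by its pullback along
   the projection v - l(v) x, which changes Q by a single product. *)
Lemma finite_rank_bilinear Q :
  symmetric_bilinear Q -> vanishes_cofinitely (fun v => Q v v) ->
  exists d (l l' : nat -> V -> k),
    [/\ forall j, scalar (l j), forall j, scalar (l' j) &
    forall u v, Q u v = \sum_(j < d) (l j u * l' j v + l' j u * l j v)].
Proof.
move=> bQ [U cU]; elim/finite_codim_proper_ind: cU Q bQ.
  move=> Q [Q1 Qs] Q0; exists 0%N, (fun _ _ => 0), (fun _ _ => 0).
  split=> [j a u v|j a u v|u v]; rewrite ?mulr0 ?addr0 //.
  rewrite big_ord0; apply: (mulfI two_neq0); have := Q0 (u + v) I.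
  rewrite (scalarD _ _ (Q1 _)) !(Qs _ (u + v)) !(scalarD _ _ (Q1 _)) (Qs v u) !Q0 //.
  by rewrite mulr0 => <-; ring.
move=> {}U l x cU IH ll Ux lx Q bQ Q0; have [Q1 Qs] := bQ.
have p_lin := linear_hyperplane_proj x ll.
have [|d [m [m' [lm lm' QE]]]] := IH _ (symmetric_bilinear_comp p_lin bQ).
  by move=> v Uv; apply/Q0/mem_hyperplane_proj => //; apply: finite_codim_subspace.
pose h v := Q x v - 2%:R^-1 * Q x x * l v.
have lh : scalar h by move=> a u v; rewrite /h !(Qs x) Q1 ll; ring.
exists d.+1, (fun j => if j is i.+1 then m i else l),
  (fun j => if j is i.+1 then m' i else h).
split=> [[|j]|[|j]|u v] //; rewrite big_ord_recl -QE /h /=.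
have -> a b : Q (a - l a *: x) (b - l b *: x) =
    Q a b - l a * Q x b - l b * Q x a + l a * l b * Q x x.
  rewrite addrC -scaleNr Q1 !(Qs _ (b - _)) [b - _]addrC -scaleNr !Q1.
  by rewrite (Qs b a) (Qs b x); ring.
by field.
Qed.

Lemma finite_rank_trilinear T :
  symmetric_trilinear T -> vanishes_cofinitely (fun v => T v v v) ->
  exists d (l : nat -> V -> k) (Q : nat -> V -> V -> k),
    [/\ forall j, scalar (l j), forall j u v, Q j u v = Q j v u &
    forall u v w, T u v w =
      \sum_(j < d) (l j u * Q j v w + l j v * Q j u w + l j w * Q j u v)].
Proof.
move=> tT [U cU]; elim/finite_codim_proper_ind: cU T tT.
  move=> T tT T0; exists 0%N, (fun _ _ => 0), (fun _ _ _ => 0).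
  split=> [j a u v|//|u v w]; first by rewrite mulr0 addr0.
  rewrite big_ord0; apply: (mulfI (natr6_neq0 two_neq0 three_neq0)).
  by rewrite cube_polarization // !T0 //; ring.
move=> {}U l x cU IH ll Ux lx T tT T0.
have p_lin := linear_hyperplane_proj x ll.
have [|d [m [Q [lm Qs TE]]]] := IH _ (symmetric_trilinear_comp p_lin tT).
  by move=> v Uv; apply/T0/mem_hyperplane_proj => //; apply: finite_codim_subspace.
pose h v w := T x v w - 2%:R^-1 * (l v * T x x w + l w * T x x v)
  + 3%:R^-1 * (l v * l w * T x x x).
exists d.+1, (fun j => if j is i.+1 then m i else l),
  (fun j => if j is i.+1 then Q i else h).
split=> [[|j]|[|j] u v|u v w] //; first by rewrite /h (triC23 tT x u v); ring.
rewrite big_ord_recl -TE /h /=.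
rewrite -!scaleNr !(triD1 tT, triD2 tT, triD3 tT, triZ1 tT, triZ2 tT, triZ3 tT).
rewrite (triC12 tT u x x) (triC23 tT x u x) (triC12 tT u x) (triC23 tT u v x).
rewrite (triC12 tT u x v) (triC23 tT x v x).
by field; rewrite two_neq0 three_neq0.
Qed.

End FiniteRank.

(** * Finitely supported coordinate vectors *)

Section VecModule.
Variables (k : fieldType) (I : choiceType).
Local Notation vec := (vec k I).
Implicit Types (u v w : vec) (i j : I).

Lemma vlincombE (a : k) u v i : vlincomb a u v i = a * u i + v i.
Proof.
rewrite /vlincomb fsfunE inE; case: (finsuppP u) => //; case: (finsuppP v) => //=.
by rewrite mulr0 addr0.
Qed.

Definition vec0 : vec := [fsfun].
Definition vadd u v := vlincomb 1 u v.
Definition vopp u := vlincomb (-1) u vec0.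
Definition vscale (a : k) u := vlincomb a u vec0.

Lemma vec0E i : vec0 i = 0. Proof. by rewrite fsfunE. Qed.

Fact vaddA : associative vadd.
Proof. by move=> u v w; apply/fsfunP => i; rewrite !vlincombE; ring. Qed.
Fact vaddC : commutative vadd.
Proof. by move=> u v; apply/fsfunP => i; rewrite !vlincombE; ring. Qed.
Fact vadd0 : left_id vec0 vadd.
Proof. by move=> u; apply/fsfunP => i; rewrite !vlincombE vec0E; ring. Qed.
Fact vaddN : left_inverse vec0 vopp vadd.
Proof. by move=> u; apply/fsfunP => i; rewrite !vlincombE !vec0E; ring. Qed.

HB.instance Definition _ := Choice.on vec.
HB.instance Definition _ := GRing.isZmodule.Build vec vaddA vaddC vadd0 vaddN.

Fact vscaleA (a b : k) u : vscale a (vscale b u) = vscale (a * b) u.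
Proof. by apply/fsfunP => i; rewrite !vlincombE !vec0E; ring. Qed.
Fact vscale1 : left_id 1 vscale.
Proof. by move=> u; apply/fsfunP => i; rewrite !vlincombE !vec0E; ring. Qed.
Fact vscaleDr : right_distributive vscale +%R.
Proof. by move=> a u v; apply/fsfunP => i; rewrite !vlincombE !vec0E; ring. Qed.
Fact vscaleDl u : {morph vscale^~ u : a b / a + b}.
Proof. by move=> a b; apply/fsfunP => i; rewrite !vlincombE !vec0E; ring. Qed.

HB.instance Definition _ :=
  GRing.Zmodule_isLmodule.Build k vec vscaleA vscale1 vscaleDr vscaleDl.

Lemma vlincomb_lmod (a : k) u v : vlincomb a u v = a *: u + v.
Proof. by apply/fsfunP => i; rewrite !vlincombE vec0E; ring. Qed.

Lemma vec_coord_scalar i : scalar (fun v : vec => v i).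
Proof. by move=> a u v; rewrite -vlincomb_lmod vlincombE. Qed.

Lemma vecDE u v i : (u + v) i = u i + v i.
Proof. exact: scalarD (vec_coord_scalar i). Qed.

Lemma vecZE (a : k) u i : (a *: u) i = a * u i.
Proof. exact: (scalable_linear (vec_coord_scalar i)). Qed.

Definition bvec i : vec := [fsfun x in [fset i]%fset => 1].

Lemma bvecE i j : bvec i j = (j == i)%:R.
Proof. by rewrite fsfunE inE; case: eqP. Qed.

End VecModule.

Definition symmetric3 (I T : Type) (F : I -> I -> I -> T) :=
  (forall i j l, F i j l = F j i l) /\ (forall i j l, F i j l = F i l j).

Section LinearExtension.
Variables (k : fieldType) (I : choiceType).
Implicit Types (V W : lmodType k) (u v w : vec k I) (h : I -> k).

Definition linext V (psi : I -> V) u : V := \sum_(i <- finsupp u) u i *: psi i.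

Lemma linext_fset V (psi : I -> V) u (S : {fset I}) : (finsupp u `<=` S)%fset ->
  linext psi u = \sum_(i <- S) u i *: psi i.
Proof.
move=> uS; rewrite /linext (big_fset_incl _ uS) // => i _ iu.
by rewrite fsfun_dflt // scale0r.
Qed.

Lemma linext_linear V (psi : I -> V) : linear (linext psi).
Proof.
move=> a u v; set w := a *: u + v; pose S := (finsupp u `|` finsupp v `|` finsupp w)%fset.
have Su : (finsupp u `<=` S)%fset by rewrite /S -fsetUA fsubsetUl.
have Sv : (finsupp v `<=` S)%fset by rewrite /S fsubsetU // fsubsetUr.
have Sw : (finsupp w `<=` S)%fset by rewrite fsubsetUr.
rewrite (linext_fset _ Su) (linext_fset _ Sv) (linext_fset _ Sw) scaler_sumr -big_split.
by apply: eq_bigr => i _ /=; rewrite /w vec_coord_scalar scalerDl scalerA.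
Qed.

HB.instance Definition _ V (psi : I -> V) :=
  GRing.isLinear.Build k (vec k I) V *:%R (linext psi) (linext_linear psi).

Lemma eq_linext V (psi psi' : I -> V) u :
  {in finsupp u, psi =1 psi'} -> linext psi u = linext psi' u.
Proof. by move=> E; apply: eq_big_seq => i iu; rewrite E. Qed.

Lemma linextD V (psi psi' : I -> V) u :
  linext (fun i => psi i + psi' i) u = linext psi u + linext psi' u.
Proof. by rewrite -big_split; apply: eq_bigr => i _; rewrite scalerDr. Qed.

Lemma linext_bvec V (psi : I -> V) i : linext psi (bvec k i) = psi i.
Proof.
have S : (finsupp (bvec k i) `<=` [fset i])%fset.
  apply/fsubsetP => j; rewrite mem_finsupp bvecE inE.
  by case: (j == i) => //; rewrite mulr0n eqxx.
by rewrite (linext_fset _ S) big_seq_fset1 bvecE eqxx scale1r.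
Qed.

Lemma linear_linext V W (phi : V -> W) (psi : I -> V) u :
  linear phi -> phi (linext psi u) = linext (phi \o psi) u.
Proof. exact: linear_lincomb. Qed.

Lemma linext_id u : linext (@bvec k I) u = u.
Proof.
apply/fsfunP => j; rewrite (scalar_sum _ _ _ (vec_coord_scalar j)).
under eq_bigr => i _ do rewrite bvecE.
case: (finsuppP u j) => [ju|ju]; last first.
  rewrite (big_fsetD1 j) //= eqxx mulr1 big1_fset ?addr0 // => i.
  by rewrite !inE eq_sym => /andP[/negPf-> _] _; rewrite mulr0.
rewrite big_seq big1 // => i iu; case: eqP => [ji|]; last by rewrite mulr0.
by rewrite ji iu in ju.
Qed.

Lemma lspan_linext V (psi : I -> V) x :
  lspan (range psi) x -> exists u, x = linext psi u.
Proof.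
suff: lspan (range psi) `<=` range (linext psi).
  by move=> sub_range /sub_range[u _ <-]; exists u.
apply: smallest_sub; last first.
  by move=> _ [i _ <-]; exists (bvec k i); rewrite ?linext_bvec.
split=> [|a _ _ [u _ <-] [v _ <-]]; first by exists 0; rewrite ?linear0.
by exists (a *: u + v); rewrite ?linearP.
Qed.

Definition linform h u : k := linext (h : I -> k^o) u.

Lemma linformE h u : linform h u = \sum_(i <- finsupp u) u i * h i.
Proof. by []. Qed.

Lemma linform_scalar h : scalar (linform h).
Proof. exact: (linext_linear (h : I -> k^o)). Qed.

Lemma linform_bvec h i : linform h (bvec k i) = h i.
Proof. exact: (linext_bvec (h : I -> k^o)). Qed.

Lemma eq_linform h h' u : h =1 h' -> linform h u = linform h' u.
Proof. by move=> E; apply: (@eq_linext k^o) => i _; apply: E. Qed.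

Lemma linformZ a h u : linform (fun i => a * h i) u = a * linform h u.
Proof. by rewrite !linformE mulr_sumr; apply: eq_bigr => i _; rewrite mulrCA. Qed.

Lemma linform_sum d (c : 'I_d -> k) (h : 'I_d -> I -> k) u :
  linform (fun i => \sum_(r < d) c r * h r i) u = \sum_(r < d) c r * linform (h r) u.
Proof.
rewrite linformE; under eq_bigr => i _ do rewrite mulr_sumr.
rewrite exchange_big; apply: eq_bigr => r _; rewrite linformE mulr_sumr.
by apply: eq_bigr => i _; rewrite mulrCA.
Qed.

Lemma scalar_linext V (l : V -> k) (psi : I -> V) u :
  scalar l -> l (linext psi u) = linform (l \o psi) u.
Proof. exact: (@linear_linext V k^o). Qed.

Lemma linextE (J : choiceType) (psi : I -> vec k J) u j :
  linext psi u j = linform (fun i => psi i j) u.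
Proof. exact: scalar_linext (vec_coord_scalar j). Qed.

Definition bilform (H : I -> I -> k) u v := linform (fun i => linform (H i) v) u.

Definition triform (F : I -> I -> I -> k) u v w := linform (fun i => bilform (F i) v w) u.

Lemma bilform_bvec H i j : bilform H (bvec k i) (bvec k j) = H i j.
Proof. by rewrite /bilform !linform_bvec. Qed.

Lemma triform_bvec F i j l : triform F (bvec k i) (bvec k j) (bvec k l) = F i j l.
Proof. by rewrite /triform linform_bvec bilform_bvec. Qed.

Lemma bilform_exchange H u v : bilform H u v = bilform (fun i j => H j i) v u.
Proof.
rewrite /bilform !linformE; under eq_bigr => i _ do rewrite linformE mulr_sumr.
rewrite exchange_big; apply: eq_bigr => j _ /=; rewrite linformE mulr_sumr.
by apply: eq_bigr => i _; rewrite mulrCA.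
Qed.

Lemma bilform_symmetric H : (forall i j, H i j = H j i) -> symmetric_bilinear (bilform H).
Proof.
move=> Hs; split=> [v|u v]; first exact: linform_scalar.
by rewrite bilform_exchange; apply: eq_linform => i; apply: eq_linform => j; apply: Hs.
Qed.

Lemma bilform_sum d (c : 'I_d -> k) (H : 'I_d -> I -> I -> k) u v :
  bilform (fun i j => \sum_(r < d) c r * H r i j) u v = \sum_(r < d) c r * bilform (H r) u v.
Proof. by rewrite -linform_sum; apply: eq_linform => i; apply: linform_sum. Qed.

Lemma bilform_products d (l l' : 'I_d -> I -> k) u v :
  bilform (fun i j => \sum_(r < d) (l r i * l' r j + l' r i * l r j)) u v =
  \sum_(r < d) (linform (l r) u * linform (l' r) v + linform (l' r) u * linform (l r) v).
Proof.
transitivity (linform (fun i =>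
    \sum_(r < d) (l r i * linform (l' r) v + l' r i * linform (l r) v)) u).
  apply: eq_linform => i; rewrite linformE; under eq_bigr => j _ do rewrite mulr_sumr.
  rewrite exchange_big; apply: eq_bigr => r _ /=; rewrite !linformE !mulr_sumr -big_split.
  by apply: eq_bigr => j _ /=; ring.
rewrite linformE; under eq_bigr => i _ do rewrite mulr_sumr.
rewrite exchange_big; apply: eq_bigr => r _ /=.
rewrite !(linformE _ u) !mulr_suml -big_split.
by apply: eq_bigr => i _ /=; ring.
Qed.

Lemma triform_symmetric F : symmetric3 F -> symmetric_trilinear (triform F).
Proof.
move=> [F12 F23]; split=> [v w|u v w|u v w]; first exact: linform_scalar.
  transitivity (bilform (fun i j => linform (F i j) w) u v) => //.
  rewrite bilform_exchange; apply: eq_linform => i; apply: eq_linform => j.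
  by apply: eq_linform => l; apply: F12.
by apply: eq_linform => i; apply: (bilform_symmetric _).2 => j l; apply: F23.
Qed.

Lemma triform_subr (F G : I -> I -> I -> k) u v w :
  triform (fun i j l => F i j l - G i j l) u v w = triform F u v w - triform G u v w.
Proof.
rewrite /triform /bilform !linformE -sumrB; apply: eq_bigr => i _.
rewrite !linformE -mulrBr -sumrB; congr (_ * _); apply: eq_bigr => j _.
rewrite !linformE -mulrBr -sumrB; congr (_ * _).
by apply: eq_bigr => l _; rewrite mulrBr.
Qed.

Lemma symmetric3_tri V (B : V -> V -> V -> k) (x : I -> V) :
  symmetric_trilinear B -> symmetric3 (fun i j l => B (x i) (x j) (x l)).
Proof. by move=> tB; split=> *; [exact: triC12 | exact: triC23]. Qed.

Lemma tri_linext V (B : V -> V -> V -> k) (x : I -> V) u v w : symmetric_trilinear B ->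
  B (linext x u) (linext x v) (linext x w) =
  triform (fun i j l => B (x i) (x j) (x l)) u v w.
Proof.
move=> tB; rewrite (scalar_linext _ _ (tri_scalar1 tB _ _)); apply: eq_linform => i /=.
rewrite (scalar_linext _ _ (tri_scalar2 tB _ _)); apply: eq_linform => j /=.
by rewrite (scalar_linext _ _ (tri_scalar3 tB _ _)).
Qed.

End LinearExtension.

Lemma big_ord_seq (R : nmodType) Q (s : seq nat) (F : nat -> R) : uniq s ->
  {in s, forall q, (q < Q)%N} -> (forall q, q \notin s -> F q = 0) ->
  \sum_(q < Q) F q = \sum_(q <- s) F q.
Proof.
move=> us sQ F0; rewrite -(big_mkord xpredT F) (bigID (mem s)) /=.
rewrite [X in _ + X]big1 ?addr0 => [|q /F0//]; rewrite -big_filter.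
apply: perm_big; apply: uniq_perm => [||q] //; first by rewrite filter_uniq // iota_uniq.
by rewrite mem_filter mem_index_iota andb_idr //= => /sQ.
Qed.

Section NatIndexed.
Variable k : fieldType.
Implicit Type t : vec k nat.

Definition vanishes_from (h : nat -> k) N := forall p, (N <= p)%N -> h p = 0.

Lemma vec_nat_bound t : exists N, vanishes_from t N.
Proof.
exists (\max_(p <- finsupp t) p).+1 => p; rewrite ltnNge => /negP Np.
by apply: fsfun_dflt; apply/negP => pt; apply: Np; apply: leq_bigmax_seq.
Qed.

Lemma linext_ord (V : lmodType k) (psi : nat -> V) t N :
  vanishes_from t N -> linext psi t = \sum_(p < N) t p *: psi p.
Proof.
move=> tN; rewrite (@big_ord_seq _ _ (finsupp t) (fun p => t p *: psi p)) => [||p|p pt] //.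
- exact: fset_uniq.
- by rewrite mem_finsupp ltnNge; apply: contra => /tN->.
by rewrite fsfun_dflt // scale0r.
Qed.

Lemma linform_nat h t N :
  vanishes_from t N -> linform h t = \sum_(0 <= p < N) t p * h p.
Proof. by move=> tN; rewrite big_mkord; apply: (linext_ord (h : nat -> k^o)). Qed.

Lemma bilform_nat H t N : vanishes_from t N ->
  bilform H t t = \sum_(0 <= i < N) \sum_(0 <= j < N) H i j * t i * t j.
Proof.
move=> tN; rewrite /bilform (linform_nat _ tN); apply: eq_bigr => i _.
by rewrite (linform_nat _ tN) mulr_sumr; apply: eq_bigr => j _; ring.
Qed.

Lemma triform_nat F t N : vanishes_from t N -> triform F t t t =
  \sum_(0 <= i < N) \sum_(0 <= j < N) \sum_(0 <= l < N) F i j l * t i * t j * t l.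
Proof.
move=> tN; rewrite /triform (linform_nat _ tN); apply: eq_bigr => i _.
rewrite (bilform_nat _ tN) mulr_sumr; apply: eq_bigr => j _.
by rewrite mulr_sumr; apply: eq_bigr => l _; ring.
Qed.

End NatIndexed.

(** * Solving quadratic equations deep inside a non-degenerate space *)

Lemma exists_root (k : closedFieldType) n (a : k) : exists x, x ^+ n.+1 = a.
Proof.
have [x xE] := @solve_monicpoly k n.+1 (fun i => if i == 0%N then a else 0) isT.
exists x; rewrite xE big_ord_recl /= mulr1 big1 ?addr0 // => i _.
by rewrite mul0r.
Qed.

Lemma primitive_cube_root (k : closedFieldType) :
  3%:R != 0 :> k -> exists2 z : k, z ^+ 3 = 1 & z != 1.
Proof.
move=> three_neq0; have [z] := @solve_monicpoly k 2 (fun=> - 1) isT.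
rewrite !big_ord_recl big_ord0 /= /bump /= expr0 expr1 => zE; exists z.
  by rewrite exprS zE; ring: zE.
apply/eqP=> z1; case/negP: three_neq0; apply/eqP.
by transitivity (z ^+ 2 + z + 1); [rewrite z1; ring | rewrite zE; ring].
Qed.

Section Solve.
Variables (k : closedFieldType) (V : lmodType k) (B : V -> V -> V -> k).
Hypotheses (tB : symmetric_trilinear B) (two_neq0 : 2%:R != 0 :> k).
Implicit Types (os D : seq V) (tau : nat -> k).
Local Notation K := (residual_kernel B).

Section AttainedValues.
Variables (os : seq V) (U : set V).
Hypothesis cU : finite_codim U.
Let n := size os.
Let sU : subspace U := finite_codim_subspace cU.

Definition quad_values v : 'rV[k]_n := \row_i B os`_i v v.

Definition attains (A : 'M[k]_n) D := forall tau : 'rV_n, (tau <= A)%MS ->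
  exists a, [/\ lspan [set` D] a, U a & quad_values a = tau].

Lemma attains_adds A D v : attains A D -> U v -> tri_orth B (os ++ D) v ->
  attains (A + quad_values v)%MS (v :: D).
Proof.
move=> attA Uv ov tau /sub_addsmxP[[c1 c2] /= ->].
have [a [Da Ua <-]] := attA _ (submxMl c1 A); have [s sE] := exists_root 1 (c2 0 0).
exists (a + s *: v); split.
- apply: subspaceDZ (lspan_subspace _) _ _; last by apply: mem_lspan; rewrite /= mem_head.
  by apply: lspanS Da => d; rewrite /= inE orbC => ->.
- exact: subspaceDZ.
rewrite [c2]mx11_scalar mul_scalar_mx; apply/rowP=> i; rewrite !mxE.
rewrite (quadD_orthZ tB _ ov) ?sE //.
  by apply: mem_lspan; rewrite /= mem_cat mem_nth.
by apply: lspanS Da => d; rewrite /= mem_cat orbC => ->.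
Qed.

Lemma exists_maximal_attains : exists A D, attains A D /\
  forall v, U v -> tri_orth B (os ++ D) v -> (quad_values v <= A)%MS.
Proof.
pose P m := `[< exists A D, \rank A = m /\ attains A D >].
have exP : exists m, P m.
  exists 0%N; apply/asboolP; exists 0, [::]; rewrite mxrank0; split=> // tau.
  rewrite submx0 => /eqP->; exists 0; split; [exact: (lspan_subspace _).1 | exact: sU.1 |].
  by apply/rowP=> i; rewrite !mxE (scalar0 (tri_scalar2 tB _ _)).
have leP m : P m -> (m <= n)%N by move=> /asboolP[A [D [<- _]]]; apply: rank_leq_col.
have [_ /asboolP[A [D [<- attA]]] maxA] := ex_maxnP exP leP.
exists A, D; split=> // v Uv ov.
have /maxA leA : P (\rank (A + quad_values v)%MS).
  apply/asboolP; exists (A + quad_values v)%MS, (v :: D); split=> //.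
  exact: attains_adds.
have : (A + quad_values v <= A)%MS.
  by rewrite -(mxrank_leqif_sup (addsmxSl A _)) eqn_leq leA mxrankS // addsmxSl.
by rewrite addsmx_sub => /andP[].
Qed.

End AttainedValues.

Definition compatible os tau := forall c : nat -> k,
  K (\sum_(i < size os) c i *: os`_i) -> \sum_(i < size os) c i * tau i = 0.

Lemma compatible_independent os tau : independent_mod K os -> compatible os tau.
Proof. by move=> ios c Kc; apply: big1 => i _; rewrite (ios c) ?mul0r. Qed.

Lemma compatible0 os : compatible os (fun=> 0).
Proof. by move=> c _; apply: big1 => i _; rewrite mulr0. Qed.

Lemma compatible_cat (xs es : seq V) (tau : nat -> k) :
  independent_mod K xs -> {in es, forall x, K x} ->
  compatible (xs ++ es) (fun i => if (i < size xs)%N then tau i else 0).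
Proof.
move=> ixs esK c; rewrite size_cat !big_split_ord /= => Kc.
rewrite [X in _ + X]big1 => [|i _]; last by rewrite ltnNge leq_addr mulr0.
rewrite addr0 big1 // => i _; rewrite ixs ?mul0r //.
have sK := residual_kernel_subspace tB.
move: Kc; under [X in X + _]eq_bigr => j _ do rewrite nth_cat ltn_ord.
under [X in _ + X]eq_bigr => j _ do rewrite nth_cat ltnNge leq_addr addKn /=.
set y := \sum_(j < size es) _; move=> Kc; rewrite -(addrK y (\sum_(j < size xs) _)).
apply: (subspaceB sK) => //; apply: (subspace_lincomb _ sK) => j _.
by apply: esK; apply: mem_nth.
Qed.

Lemma solve_quadrics os tau U : finite_codim U -> compatible os tau ->
  exists2 u, U u & forall i, (i < size os)%N -> B os`_i u u = tau i.
Proof.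
move=> cU ctau; have [A [D [attA maxA]]] := exists_maximal_attains os cU.
have [|u [_ Uu qu]] := attA (\row_i tau i); last first.
  by exists u => // i ios; move/rowP/(_ (Ordinal ios)): qu; rewrite !mxE.
have [C AC] : exists C : 'M_(size os), forall t : 'rV_(size os), (t <= A)%MS = (t *m C == 0).
  by exists (cokermx A) => t; rewrite submxE.
rewrite AC; apply/eqP/matrixP=> r j; rewrite {r}ord1 [RHS]mxE.
pose c (i : nat) := if insub i is Some i' then C i' j else 0.
have rowE (x : nat -> k) : (\row_i x i *m C) 0 j = \sum_(i < size os) c i * x i.
  by rewrite mxE; apply: eq_bigr => i _; rewrite !mxE /c valK mulrC.
rewrite rowE; apply: ctau; exists (U `&` tri_orth B (os ++ D)).
  exact: finite_codimI cU (finite_codim_tri_orth tB _).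
move=> v [Uv ov]; rewrite (scalar_sum _ _ _ (tri_scalar1 tB v v)).
rewrite -(rowE (fun i => B os`_i v v)).
by move: (maxA v Uv ov); rewrite AC => /eqP/matrixP->; rewrite mxE.
Qed.

Hypothesis nondeg : ~ vanishes_cofinitely (fun v => B v v v).

(* If v is orthogonal to a and q(a) = - q(v), then a + v and a - v are isotropic
   for q, and f(a + v) - f(a - v) = 2 f(v). *)
Lemma isotropic_nonzero os U : finite_codim U ->
  exists v, [/\ U v, forall o, o \in os -> B o v v = 0 & B v v v != 0].
Proof.
move=> cU; have sU := finite_codim_subspace cU.
have [A [D [attA maxA]]] := exists_maximal_attains os cU.
have [v [Uv ov] fv] := not_vanishes_cofinitely nondeg
  (finite_codimI cU (finite_codim_tri_orth tB (os ++ D))).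
have [|a [Da Ua qa]] := attA (- quad_values os v); first by rewrite eqmx_opp maxA.
have {}Da : lspan [set` os ++ D] a by apply: lspanS Da => d; rewrite /= mem_cat orbC => ->.
have iso e o : e ^+ 2 = 1 -> o \in os -> B o (a + e *: v) (a + e *: v) = 0.
  move=> e2 oos; rewrite (quadD_orthZ tB _ ov) ?e2 ?mul1r //; last first.
    by apply: mem_lspan; rewrite /= mem_cat oos.
  have io : (index o os < size os)%N by rewrite index_mem.
  by move/rowP/(_ (Ordinal io)): qa; rewrite !mxE /= nth_index // => ->; rewrite addNr.
pose cube e := B (a + e *: v) (a + e *: v) (a + e *: v).
have cubeE : 2%:R * B v v v = cube 1 - cube (-1).
  by rewrite /cube !(cubeD_orthZ tB _ ov Da); ring.
have [cube1|cube1] := eqVneq (cube 1) 0; last first.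
  by exists (a + 1 *: v); split=> // [|o]; [exact: subspaceDZ | apply: iso; rewrite expr1n].
exists (a + (-1) *: v); split=> [|o|]; first exact: subspaceDZ.
  by apply: iso; rewrite sqrrN expr1n.
apply: contra fv => /eqP cubeN1.
by move/eqP: cubeE; rewrite cube1 /cube cubeN1 subr0 mulf_eq0 (negPf two_neq0).
Qed.

Lemma solve_system os tau c U : finite_codim U -> compatible os tau ->
  exists v, [/\ U v, forall i, (i < size os)%N -> B os`_i v v = tau i & B v v v = c].
Proof.
move=> cU ctau; have sU := finite_codim_subspace cU.
have [u Uu qu] := solve_quadrics cU ctau.
have [v [[Uv ov] qv fv]] := isotropic_nonzero (u :: os)
  (finite_codimI cU (finite_codim_tri_orth tB (u :: os))).
have [s sE] := exists_root 2 ((c - B u u u) / B v v v).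
have uu : lspan [set` u :: os] u by apply: mem_lspan; rewrite /= mem_head.
exists (u + s *: v); split; first exact: subspaceDZ.
  move=> i ios; have ios' : os`_i \in u :: os by rewrite inE mem_nth ?orbT.
  by rewrite (quadD_orthZ tB _ ov) ?qu ?qv ?mulr0 ?addr0 //; apply: mem_lspan.
by rewrite (cubeD_orthZ tB _ ov uu) qv ?mem_head // mulr0 addr0 sE mulfVK // addrC subrK.
Qed.

Section InfiniteResidualRank.
Hypotheses (three_neq0 : 3%:R != 0 :> k) (infK : infinite_codim K).

(* For w outside of the span, q is corrected by a vector v orthogonal to w; then
   w + v and w - v cannot both lie in the span. *)
Lemma isotropic_outside os U : finite_codim U -> independent_mod K os ->
  exists w, [/\ U w, ~ span_mod K os w & forall o, o \in os -> B o w w = 0].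
Proof.
move=> cU ios; have sU := finite_codim_subspace cU.
have [w Uw Dw] := infinite_codim_escape os infK cU.
have [v [Uv ov] qv] := solve_quadrics
  (finite_codimI cU (finite_codim_tri_orth tB (w :: os)))
  (@compatible_independent _ (fun i => - B os`_i w w) ios).
have iso e o : e ^+ 2 = 1 -> o \in os -> B o (w + e *: v) (w + e *: v) = 0.
  move=> e2 oos; rewrite (quadD_orthZ tB _ ov) ?e2 ?mul1r; last 2 first.
  - by apply: mem_lspan; rewrite /= inE oos orbT.
  - by apply: mem_lspan; rewrite /= mem_head.
  by have := qv (index o os); rewrite index_mem nth_index // => -> //; rewrite subrr.
have Uwv e : U (w + e *: v) by exact: subspaceDZ.
have [Dplus|] := pselect (span_mod K os (w + 1 *: v)); last first.
  by exists (w + 1 *: v); split=> // o; apply: iso; rewrite expr1n.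
exists (w + (-1) *: v); split=> // [Dminus|o]; last by apply: iso; rewrite sqrrN expr1n.
apply: Dw; have sS : subspace (span_mod K os) := lspan_subspace _.
have := subspaceZ 2%:R^-1 sS (subspaceD sS Dplus Dminus).
rewrite addrACA -scalerDl subrr scale0r addr0 -mulr2n -scaler_nat scalerA mulVf //.
by rewrite scale1r.
Qed.

(* Same correction for f, with two cube roots of unity instead of two signs. *)
Lemma null_outside os U : finite_codim U -> independent_mod K os ->
  exists w, [/\ U w, ~ span_mod K os w, forall o, o \in os -> B o w w = 0 & B w w w = 0].
Proof.
move=> cU ios; have sU := finite_codim_subspace cU.
have [w [Uw Dw qw]] := isotropic_outside cU ios.
have [u [[Uu ou] qu fu]] := solve_system (- B w w w)
  (finite_codimI cU (finite_codim_tri_orth tB (w :: os))) (@compatible0 (w :: os)).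
have ww : lspan [set` w :: os] w by apply: mem_lspan; rewrite /= mem_head.
have null z : z ^+ 3 = 1 -> [/\ U (w + z *: u),
    forall o, o \in os -> B o (w + z *: u) (w + z *: u) = 0
    & B (w + z *: u) (w + z *: u) (w + z *: u) = 0].
  move=> z3; split; first exact: subspaceDZ.
    move=> o oos; have oos' : o \in w :: os by rewrite inE oos orbT.
    rewrite (quadD_orthZ tB _ ou) ?qw ?add0r //; last exact: mem_lspan.
    have := qu (index o (w :: os)); rewrite index_mem nth_index // => -> //.
    exact: mulr0.
  by rewrite (cubeD_orthZ tB _ ou ww) (qu 0%N) // fu z3 mulr0 addr0 mul1r subrr.
have [z z3 z1] := primitive_cube_root three_neq0.
have [Dwu|] := pselect (span_mod K os (w + 1 *: u)); last first.
  by have [Uwu qwu fwu] := null 1 (expr1n _ _); exists (w + 1 *: u); split.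
have [Uwzu qwzu fwzu] := null z z3; exists (w + z *: u); split=> // Dwzu.
apply: Dw; have sS : subspace (span_mod K os) := lspan_subspace _.
have wE : w + z *: u - z *: (w + 1 *: u) = (1 - z) *: w.
  by rewrite scale1r scalerDr opprD addrACA subrr addr0 scalerBl scale1r.
have nz1 : 1 - z != 0 by rewrite subr_eq0 eq_sym.
rewrite -[w]scale1r -(mulVf nz1) -scalerA -wE.
exact: subspaceZ _ sS (subspaceB sS Dwzu (subspaceZ z sS Dwu)).
Qed.

(* A null vector outside of the span can be added to a solution orthogonal to it. *)
Lemma solve_system_outside os tau c U : finite_codim U -> independent_mod K os ->
  exists v, [/\ U v, ~ span_mod K os v,
    forall i, (i < size os)%N -> B os`_i v v = tau i & B v v v = c].
Proof.
move=> cU ios; have sU := finite_codim_subspace cU.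
have [w [Uw Dw qw fw]] := null_outside cU ios.
pose tau' i := if (i < size os)%N then tau i else 0.
have [v [[Uv ov] qv fv]] := solve_system c
  (finite_codimI cU (finite_codim_tri_orth tB (rcons os w)))
  (@compatible_independent _ tau' (independent_mod_rcons ios Dw)).
have {qv} [qv wv] : (forall i, (i < size os)%N -> B os`_i v v = tau i) /\ B w v v = 0.
  split=> [i ios'|].
    by have := qv i; rewrite size_rcons nth_rcons ios' /tau' ios' ltnW // => ->.
  by have := qv (size os); rewrite size_rcons nth_rcons ltnn eqxx /tau' ltnn => ->.
have [Dv|] := pselect (span_mod K os v); last by exists v.
have ww : lspan [set` rcons os w] w by apply: mem_lspan; rewrite /= mem_rcons mem_head.
exists (w + v); split.
- exact: (subspaceD sU).
- have sS : subspace (span_mod K os) := lspan_subspace _.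
  by move=> Dwv; apply: Dw; rewrite -(addrK v w); apply: (subspaceB sS).
- move=> i ios'; rewrite (quadD_orth tB ov) ?qw ?qv ?add0r ?mem_nth //.
  by apply: mem_lspan; rewrite /= mem_rcons inE mem_nth ?orbT.
by rewrite (cubeD_orth tB ov ww) wv fw fv mulr0 !add0r.
Qed.

End InfiniteResidualRank.

End Solve.

(** * Standard cubic forms inside a non-degenerate space *)

Lemma dependent_sequence (X : Type) (Good : seq X -> Prop) (P : seq X -> X -> Prop) :
  Good [::] -> (forall s, Good s -> exists x, P s x /\ Good (rcons s x)) ->
  exists e : nat -> X, forall n, P (mkseq e n) (e n).
Proof.
move=> G0 step; have next (s : {s | Good s}) : {x | P (sval s) x /\ Good (rcons (sval s) x)}.
  by apply: cid; apply: step (svalP s).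
pose grow s := exist Good (rcons (sval s) (sval (next s))) (svalP (next s)).2.
pose st n := iter n grow (exist Good [::] G0); pose e n := sval (next (st n)).
have stE n : sval (st n) = mkseq e n.
  by elim: n => [//|n IH]; rewrite mkseqS -IH.
by exists e => n; rewrite -stE; have [] := svalP (next (st n)).
Qed.

Lemma big_ord_double (R : nmodType) Q (F : nat -> R) :
  \sum_(n < Q.*2) F n = \sum_(q < Q) (F q.*2 + F q.*2.+1).
Proof.
elim: Q => [|Q IH]; first by rewrite !big_ord0.
by rewrite doubleS !big_ord_recr /= IH addrA.
Qed.

Lemma sum_delta (R : pzRingType) n (i : 'I_n) (F : nat -> R) :
  \sum_(m < n) F m * (m == i :> nat)%:R = F i.
Proof.
rewrite (bigD1 i) //= eqxx mulr1 big1 ?addr0 // => m.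
by rewrite -val_eqE /= => /negPf->; rewrite mulr0.
Qed.

Section OrthogonalSequences.
Variables (k : fieldType) (V : lmodType k) (B : V -> V -> V -> k).
Hypothesis tB : symmetric_trilinear B.

Lemma cube_orth_sequence D e u : (forall n, tri_orth B (D ++ mkseq e n) (e n)) ->
  lspan [set` D] u -> forall (b : nat -> k) Q, let x n := u + \sum_(m < n) b m *: e m in
  B (x Q) (x Q) (x Q) = B u u u + \sum_(n < Q)
    (3%:R * b n ^+ 2 * B (x n) (e n) (e n) + b n ^+ 3 * B (e n) (e n) (e n)).
Proof.
move=> oe Du b Q x; elim: Q => [|Q IH]; first by rewrite /x !big_ord0 !addr0.
have Dx : lspan [set` D ++ mkseq e Q] (x Q).
  apply: (subspaceD (lspan_subspace _)).
    by apply: lspanS Du => d; rewrite /= mem_cat => ->.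
  apply: (subspace_lincomb _ (lspan_subspace _)) => m _; apply: mem_lspan.
  by rewrite /= mem_cat; apply/orP; right; apply: map_f; rewrite mem_iota /=.
have -> : x Q.+1 = x Q + b Q *: e Q by rewrite /x big_ord_recr addrA.
by rewrite (cubeD_orthZ tB _ (oe Q) Dx) IH big_ord_recr /=; ring.
Qed.

End OrthogonalSequences.

(* The cubes stand for products with those A_n whose contraction has finite rank: no
   square deep inside V can be attached to them. *)
Definition power_model (k : fieldType) (V : lmodType k) (B : V -> V -> V -> k)
  (al : pred nat) (nu : nat -> nat) (wt : nat -> k) (A E : nat -> V) :=
  forall Q (a b : nat -> k),
  let u := \sum_(q < Q) a q *: A q in let x := u + \sum_(q < Q) b q *: E q in
  B x x x = B u u u + \sum_(q < Q)
    wt q * (if al (nu q) then 3%:R * a (nu q) * b q ^+ 2 else b q ^+ 3).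

Lemma power_model_code (k : fieldType) (V : lmodType k) (B : V -> V -> V -> k)
    (T : eqType) (code : T -> nat) al nu wt A E :
  injective code -> power_model B al nu wt A E ->
  forall (a : vec k nat) (b : T -> k) (s : seq T), uniq s ->
  let u := linext A a in let x := u + \sum_(l <- s) b l *: E (code l) in
  B x x x = B u u u + \sum_(l <- s) wt (code l) * (if al (nu (code l))
    then 3%:R * a (nu (code l)) * b l ^+ 2 else b l ^+ 3).
Proof.
move=> code_inj model a b s us u x; pose codes := map code s.
pose c q := nth 0 [seq b l | l <- s] (index q codes).
have cE l : l \in s -> c (code l) = b l.
  by move=> ls; rewrite /c index_map // (nth_map l) ?index_mem // nth_index.
have c0 q : q \notin codes -> c q = 0.
  by move=> ql; rewrite /c memNindex // nth_default // size_map size_map.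
have ucodes : uniq codes by rewrite map_inj_uniq.
have [N aN] := vec_nat_bound a; pose Q := (N + (\max_(q <- codes) q).+1)%N.
have codesQ : {in codes, forall q, (q < Q)%N}.
  by move=> q qc; apply: leq_trans (leq_addl _ _); rewrite ltnS; apply: leq_bigmax_seq.
have uE : u = \sum_(q < Q) a q *: A q.
  by apply: linext_ord => p pQ; apply: aN; apply: leq_trans pQ; apply: leq_addr.
have xE : x = u + \sum_(q < Q) c q *: E q.
  rewrite (big_ord_seq (F := fun q => c q *: E q) ucodes codesQ) => [|q /c0->]; last first.
    by rewrite scale0r.
  by rewrite big_map; congr (_ + _); apply: eq_big_seq => l ls; rewrite cE.
rewrite xE uE model; congr (_ + _).
pose term q := wt q * (if al (nu q) then 3%:R * a (nu q) * c q ^+ 2 else c q ^+ 3).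
rewrite (big_ord_seq (F := term) ucodes codesQ) => [|q /c0 cq0]; last first.
  by rewrite /term cq0 !expr0n /= mulr0 if_same mulr0.
by rewrite big_map; apply: eq_big_seq => l ls; rewrite /term cE.
Qed.

Section PowerModels.
Variables (k : closedFieldType) (V : lmodType k) (B : V -> V -> V -> k).
Hypothesis tB : symmetric_trilinear B.
Implicit Types (D : seq V) (nu : nat -> nat) (wt : nat -> k).
Local Notation K := (residual_kernel B).
Hypotheses (two_neq0 : 2%:R != 0 :> k) (three_neq0 : 3%:R != 0 :> k).
Hypothesis nondeg : ~ vanishes_cofinitely (fun v => B v v v).

Lemma orth_sequence_infinite (T : nat -> nat -> k) (c : nat -> k) : infinite_codim K ->
  exists e, forall n, [/\ tri_orth B (mkseq e n) (e n),
    forall m, (m < n)%N -> B (e m) (e n) (e n) = T m n & B (e n) (e n) (e n) = c n].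
Proof.
move=> infK; have [||e eP] := @dependent_sequence V (independent_mod K)
  (fun D v => [/\ tri_orth B D v, forall m, (m < size D)%N -> B D`_m v v = T m (size D)
    & B v v v = c (size D)]).
- exact: independent_mod_nil.
- move=> D iD; have [v [oD Dv qv fv]] := solve_system_outside tB two_neq0 nondeg
    three_neq0 infK (T^~ (size D)) (c (size D)) (finite_codim_tri_orth tB D) iD.
  by exists v; split; [split | apply: independent_mod_rcons].
exists e => n; have [on qn fn] := eP n; rewrite size_mkseq in qn fn; split=> // m mn.
by rewrite -qn // nth_mkseq.
Qed.

Lemma orth_sequence_in_kernel (xs : seq V) (T : nat -> nat -> k) (c : nat -> k) :
  independent_mod K xs -> finite_codim K ->
  exists e, forall n, [/\ tri_orth B (xs ++ mkseq e n) (e n),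
    forall i, (i < size xs)%N -> B xs`_i (e n) (e n) = T i n,
    forall m, (m < n)%N -> B (e m) (e n) (e n) = 0 & B (e n) (e n) (e n) = c n].
Proof.
move=> ixs cK.
have [||e eP] := @dependent_sequence V (fun es => {in es, forall x, K x})
  (fun es v => [/\ tri_orth B (xs ++ es) v,
    forall i, (i < size xs)%N -> B xs`_i v v = T i (size es),
    forall m, (m < size es)%N -> B es`_m v v = 0 & B v v v = c (size es)]).
- by [].
- move=> es esK; have [v [[Kv ov] qv fv]] := solve_system tB two_neq0 nondeg (c (size es))
    (finite_codimI cK (finite_codim_tri_orth tB (xs ++ es)))
    (compatible_cat tB (T^~ (size es)) ixs esK).
  exists v; split; last by move=> x; rewrite mem_rcons inE => /predU1P[->|/esK].
  rewrite size_cat in qv; split=> // [i ixs'|m mes].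
    by have := qv i; rewrite nth_cat ixs'; apply; apply: ltn_addr.
  by have := qv (size xs + m)%N; rewrite ltn_add2l mes nth_cat ltnNge leq_addr addKn => ->.
exists e => n; have [on qn zn fn] := eP n; rewrite size_mkseq in qn zn fn; split=> // m mn.
by have := zn m mn; rewrite nth_mkseq.
Qed.

Lemma power_model_infinite nu wt : infinite_codim K -> (forall q, (nu q <= q)%N) ->
  exists A E, power_model B predT nu wt A E.
Proof.
move=> infK nu_le.
pose T (i n : nat) := if odd n then wt n./2 * (i == (nu n./2).*2)%:R else 0.
have [e eP] := orth_sequence_infinite T (fun=> 0) infK.
have oe n : tri_orth B ([::] ++ mkseq e n) (e n) by case: (eP n).
have qe n (m : 'I_n) : B (e m) (e n) (e n) = T m n.
  by have [_ /(_ m)] := eP n; rewrite ltn_ord => ->.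
have fe n : B (e n) (e n) (e n) = 0 by case: (eP n).
exists (fun q => e q.*2), (fun q => e q.*2.+1) => Q a b.
have cubeE (a' b' : nat -> k) :
    let x := \sum_(q < Q) a' q *: e q.*2 + \sum_(q < Q) b' q *: e q.*2.+1 in
    B x x x = \sum_(q < Q) wt q * (3%:R * a' (nu q) * b' q ^+ 2).
  pose c n := if odd n then b' n./2 else a' n./2 => x.
  have -> : x = 0 + \sum_(n < Q.*2) c n *: e n.
    rewrite add0r (big_ord_double _ (fun n => c n *: e n)) big_split /c /=.
    by congr (_ + _); apply: eq_bigr => q _; rewrite ?odd_double ?uphalf_double ?doubleK.
  rewrite (cube_orth_sequence tB oe (lspan_subspace _).1).
  rewrite (scalar0 (tri_scalar1 tB _ _)) add0r.
  under eq_bigr => n _ do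
    rewrite add0r fe mulr0 addr0 (scalar_sum _ _ _ (tri_scalar1 tB _ _)).
  rewrite (big_ord_double _ (fun n =>
    3%:R * c n ^+ 2 * \sum_(m < n) c m * B (e m) (e n) (e n))).
  apply: eq_bigr => q _.
  rewrite big1 ?mulr0 ?add0r => [|m _]; last by rewrite qe /T odd_double mulr0.
  under eq_bigr => m _ do rewrite qe /T /= odd_double uphalf_double mulrCA.
  have lt : ((nu q).*2 < q.*2.+1)%N by rewrite ltnS leq_double.
  rewrite -mulr_sumr (sum_delta (Ordinal lt)) /c /= !odd_double uphalf_double doubleK.
  by rewrite mulrCA; congr (_ * _); rewrite mulrAC.
move=> u x; suff -> : B u u u = 0 by rewrite add0r; apply: cubeE.
have /= := cubeE a (fun=> 0); rewrite -/u [X in u + X]big1 => [|q _]; last exact: scale0r.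
by rewrite addr0 => ->; apply: big1 => q _; rewrite expr0n mulr0 mulr0.
Qed.

Lemma power_model_finite nu wt (xs : seq V) : independent_mod K xs ->
  finite_codim K -> (forall q, (nu q <= q)%N) ->
  exists E, power_model B (fun n => n < size xs)%N nu wt (nth 0 xs) E.
Proof.
move=> ixs cK nu_le; pose T (i n : nat) := wt n * (i == nu n)%:R.
have [e eP] := orth_sequence_in_kernel T
  (fun n => if (nu n < size xs)%N then 0 else wt n) ixs cK.
have oe n : tri_orth B (xs ++ mkseq e n) (e n) by case: (eP n).
have qxs i n : B xs`_i (e n) (e n) = if (nu n < size xs)%N then T i n else 0.
  have [_ qn _ _] := eP n; have [ixs'|xsi] := ltnP i (size xs).
    by rewrite qn // /T; case: ltnP => // ?; rewrite ltn_eqF ?mulr0 ?(leq_trans ixs').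
  rewrite nth_default // (scalar0 (tri_scalar1 tB _ _)) /T; case: ltnP => // nu_xs.
  by rewrite gtn_eqF ?mulr0 // (leq_trans nu_xs).
have qe n (m : 'I_n) : B (e m) (e n) (e n) = 0.
  by have [_ _ /(_ m)] := eP n; rewrite ltn_ord => ->.
exists e => Q a b u x.
have Du : lspan [set` xs] u.
  have sS := lspan_subspace [set` xs]; apply: (subspace_lincomb _ sS) => i _.
  have [ixs'|xsi] := ltnP i (size xs); last by rewrite nth_default //; apply: sS.1.
  by apply: mem_lspan; apply: mem_nth.
rewrite /x (cube_orth_sequence tB oe Du); congr (_ + _); apply: eq_bigr => n _.
rewrite (triD1 tB) [X in _ * (_ + X)](scalar_sum _ _ _ (tri_scalar1 tB _ _)).
rewrite [X in _ * (_ + X)]big1 => [|m _]; last by rewrite qe mulr0.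
rewrite addr0 (scalar_sum _ _ _ (tri_scalar1 tB _ _)).
under eq_bigr => i _ do rewrite qxs.
have [_ _ _ ->] := eP n; case: ltnP => nu_xs; last first.
  by rewrite big1 => [|i _]; rewrite ?mulr0 // add0r mulrC.
have lt : (nu n < Q)%N := leq_ltn_trans (nu_le n) (ltn_ord n).
under eq_bigr => i _ do rewrite /T mulrCA.
rewrite -mulr_sumr (sum_delta (Ordinal lt)) /=; ring.
Qed.

End PowerModels.

Section ProductModels.
Variables (k : fieldType) (V : lmodType k) (B : V -> V -> V -> k).
Hypotheses (two_neq0 : 2%:R != 0 :> k) (three_neq0 : 3%:R != 0 :> k).
Variable T : countType.

Definition triple_code (l : nat * T * nat) :=
  CodeSeq.code [:: l.1.1; choice.pickle l.1.2; l.2].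

Lemma triple_code_inj : injective triple_code.
Proof.
move=> [[n t] i] [[n' t'] i'] /(can_inj CodeSeq.codeK)[-> tt' ->].
by rewrite (pcan_inj (@choice.pickleK T) tt').
Qed.

Definition code_head q := head 0%N (CodeSeq.decode q).

Lemma code_head_triple l : code_head (triple_code l) = l.1.1.
Proof. by rewrite /code_head CodeSeq.codeK. Qed.

Lemma code_head_leq q : (code_head q <= q)%N.
Proof.
rewrite /code_head; have := CodeSeq.gtn_decode q.
by case: (CodeSeq.decode q) => //= n s /andP[/ltnW].
Qed.

Definition sign1 i : k := (-1) ^+ (1 < i)%N.
Definition sign2 i : k := (-1) ^+ odd i.

Definition code_weight q : k :=
  let i := nth 0%N (CodeSeq.decode q) 2 in sign1 i * sign2 i / 24%:R.

Lemma code_weight_triple l : code_weight (triple_code l) = sign1 l.2 * sign2 l.2 / 24%:R.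
Proof. by rewrite /code_weight CodeSeq.codeK. Qed.

(* The four sign choices polarize y z, from squares, and x y z, from cubes. *)
Lemma sum_signed_powers (s x y z : k) (c : bool) :
  let form i := (if c then 0 else x) + sign1 i * y + sign2 i * z in
  \sum_(i <- iota 0 4) sign1 i * sign2 i / 24%:R *
    (if c then 3%:R * s * form i ^+ 2 else form i ^+ 3) = (if c then s else x) * y * z.
Proof.
have twentyfour_neq0 : 24%:R != 0 :> k.
  by rewrite (natrM _ 8 3) (natrM _ 4 2) (natrM _ 2 2) !mulf_neq0.
by rewrite /= !big_cons big_nil /sign1 /sign2 /= !expr1 !expr0; case: c; field.
Qed.

Definition product_model (al : pred nat) (A : nat -> V) (X Y Z : nat * T -> V) :=
  forall (a : vec k nat) (x y z : vec k (nat * T)%type),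
  let u := linext A a in let v := u + (linext X x + linext Y y + linext Z z) in
  B v v v = B u u u + linform (fun w => (if al w.1 then a w.1 else x w) * z w) y.

Lemma product_model_of_power al A E : power_model B al code_head code_weight A E ->
  exists X Y Z, product_model al A X Y Z.
Proof.
move=> model; pose F w i := E (triple_code (w, i)).
exists (fun w => if al w.1 then 0 else \sum_(i <- iota 0 4) F w i),
  (fun w => \sum_(i <- iota 0 4) sign1 i *: F w i),
  (fun w => \sum_(i <- iota 0 4) sign2 i *: F w i) => a x y z u v.
pose S := (finsupp x `|` finsupp y `|` finsupp z)%fset.
have Sx : (finsupp x `<=` S)%fset by rewrite /S -fsetUA fsubsetUl.
have Sy : (finsupp y `<=` S)%fset by rewrite /S fsubsetU // fsubsetUr.
have Sz : (finsupp z `<=` S)%fset by rewrite fsubsetUr.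
pose coef (l : nat * T * nat) :=
  (if al l.1.1 then 0 else x l.1) + sign1 l.2 * y l.1 + sign2 l.2 * z l.1.
pose L := [seq (w, i) | w <- S, i <- iota 0 4].
have uL : uniq L.
  by apply: allpairs_uniq => [||[? ?] [? ?] _ _ /= [-> ->]] //; exact: fset_uniq.
have -> : v = u + \sum_(l <- L) coef l *: E (triple_code l).
  rewrite big_allpairs /v (linext_fset _ Sx) (linext_fset _ Sy) (linext_fset _ Sz).
  rewrite -!big_split; congr (_ + _); apply: eq_bigr => w _ /=; rewrite !scaler_sumr.
  rewrite [X in X + _ + _](_ : _ =
      \sum_(i <- iota 0 4) (if al w.1 then 0 else x w) *: F w i).
    rewrite -!big_split; apply: eq_bigr => i _; rewrite /coef /= !scalerDl !scalerA.
    by rewrite (mulrC (y w)) (mulrC (z w)).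
  by case: (al _); rewrite ?scaler0 ?scaler_sumr // big1 // => i _; rewrite scale0r.
rewrite (power_model_code triple_code_inj model a coef uL) big_allpairs; congr (_ + _).
rewrite /linform (linext_fset _ Sy); apply: eq_bigr => w _.
rewrite [RHS]mulrCA [RHS]mulrA -(sum_signed_powers (a w.1)).
by apply: eq_bigr => i _; rewrite code_weight_triple code_head_triple.
Qed.

End ProductModels.

(** * Cubic forms as locally finite sums of products *)

Section SymmetricSums.
Variable R : comNzRingType.

Lemma sum_symmetric2 (F : nat -> nat -> R) N : (forall i j, F i j = F j i) ->
  \sum_(0 <= i < N) \sum_(0 <= j < N) F i j =
  \sum_(0 <= i < N) (F i i + 2%:R * \sum_(i.+1 <= j < N) F i j).
Proof.
elim: N F => [|N IH] F Fs; first by rewrite !big_nil.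
rewrite [LHS]big_nat_recl // [RHS]big_nat_recl // big_add1 /=.
under [X in _ + X = _]eq_bigr => i _ do rewrite big_nat_recl // Fs.
under [X in _ = _ + X]eq_bigr => i _ do rewrite big_add1 /=.
rewrite -(IH (fun i j => F i.+1 j.+1)) // big_split big_nat_recl //=; ring.
Qed.

Lemma sum_symmetric3 (F : nat -> nat -> nat -> R) N : symmetric3 F ->
  \sum_(0 <= i < N) \sum_(0 <= j < N) \sum_(0 <= l < N) F i j l =
  \sum_(0 <= i < N) (F i i i + 3%:R * \sum_(i.+1 <= l < N) F i i l
    + 3%:R * \sum_(i.+1 <= j < N) \sum_(i.+1 <= l < N) F i j l).
Proof.
elim: N F => [|N IH] F [F12 F23]; first by rewrite !big_nil.
have sum_split (H : nat -> nat -> R) : \sum_(0 <= i < N.+1) \sum_(0 <= j < N.+1) H i j =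
    H 0%N 0%N + \sum_(0 <= j < N) H 0%N j.+1 + \sum_(0 <= i < N) H i.+1 0%N
    + \sum_(0 <= i < N) \sum_(0 <= j < N) H i.+1 j.+1.
  rewrite big_nat_recl // big_nat_recl //.
  under [X in _ + X = _]eq_bigr => i _ do rewrite big_nat_recl //.
  by rewrite big_split /= addrA.
have shift n (H : nat -> R) : \sum_(n.+1 <= l < N.+1) H l = \sum_(n <= l < N) H l.+1.
  by rewrite big_add1.
rewrite [LHS]big_nat_recl // [RHS]big_nat_recl // !(shift 0%N) /=.
under [X in _ = _ + _ * X + _]eq_bigr => j _ do rewrite (shift 0%N).
under [X in _ = _ + X]eq_bigr => i _.
  rewrite !(shift i.+1); under [X in _ + _ * X]eq_bigr => j _ do rewrite (shift i.+1).
  over.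
rewrite -(IH (fun i j l => F i.+1 j.+1 l.+1)) // !sum_split.
under [X in _ + X = _]eq_bigr => i _ do rewrite sum_split.
rewrite !big_split /=.
have swap_middle : \sum_(0 <= i < N) F 0%N i.+1 0%N = \sum_(0 <= i < N) F 0%N 0%N i.+1.
  by apply: eq_bigr => i _; rewrite F23.
have swap_first : \sum_(0 <= i < N) F i.+1 0%N 0%N = \sum_(0 <= i < N) F 0%N 0%N i.+1.
  by rewrite -swap_middle; apply: eq_bigr => i _; rewrite F12.
have swap_middle2 : \sum_(0 <= i < N) \sum_(0 <= j < N) F i.+1 0%N j.+1 =
    \sum_(0 <= i < N) \sum_(0 <= j < N) F 0%N i.+1 j.+1.
  by apply: eq_bigr => i _; apply: eq_bigr => j _; rewrite F12.
have swap_last2 : \sum_(0 <= i < N) \sum_(0 <= j < N) F i.+1 j.+1 0%N =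
    \sum_(0 <= i < N) \sum_(0 <= j < N) F 0%N i.+1 j.+1.
  by rewrite -swap_middle2; apply: eq_bigr => i _; apply: eq_bigr => j _; rewrite F23.
by rewrite swap_middle swap_first swap_middle2 swap_last2; ring.
Qed.

End SymmetricSums.

(* A map b from nat to vectors over T is read column by column: it stands for the
   linear forms b_j(t) = sum_p t_p (b p)_j, j : T, which are the coordinates of
   [linext b t] and of which only finitely many are nonzero at each t. *)
Section Columns.
Variable k : fieldType.
Implicit Types (t : vec k nat) (n m p N : nat).

Definition trunc_vec N (h : nat -> k) : vec k nat := \sum_(m < N) h m *: bvec k (m : nat).

Lemma trunc_vecE N h m : trunc_vec N h m = (m < N)%N%:R * h m.
Proof.
rewrite (scalar_sum _ _ _ (vec_coord_scalar m)); under eq_bigr => i _ do rewrite bvecE.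
have [mN|Nm] := ltnP m N; last first.
  rewrite mul0r big1 // => i _; rewrite gtn_eqF ?mulr0 //.
  exact: leq_trans (ltn_ord i) Nm.
under eq_bigr => i _ do rewrite eq_sym.
by rewrite mul1r (sum_delta (Ordinal mN)).
Qed.

Lemma linext_trunc_vec N (h : nat -> nat -> k) t m :
  linext (fun p => trunc_vec N (h p)) t m = (m < N)%N%:R * linform (h^~ m) t.
Proof.
rewrite linextE !linformE mulr_sumr.
by apply: eq_bigr => p _; rewrite /= trunc_vecE mulrCA.
Qed.

Definition ocons (a : k) (v : vec k nat) : vec k (option nat) :=
  a *: bvec k None + linext (fun m => bvec k (Some m)) v.

Lemma ocons_None a v : ocons a v None = a.
Proof.
rewrite vecDE vecZE bvecE mulr1 linextE linformE big1 ?addr0 // => m _.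
by rewrite /= bvecE mulr0.
Qed.

Lemma ocons_Some a v m : ocons a v (Some m) = v m.
Proof.
rewrite vecDE vecZE bvecE mulr0 add0r linextE -[in RHS](linext_id v) linextE.
by apply: eq_linform => p; rewrite /= !bvecE.
Qed.

Lemma linform_ocons h a v : linform h (ocons a v) = a * h None + linform (h \o Some) v.
Proof.
rewrite linform_scalar linform_bvec (scalar_linext _ _ (linform_scalar h)).
by congr (_ + _); apply: eq_linform => m; rewrite /= linform_bvec.
Qed.

Lemma linext_ocons (a : nat -> k) (v : nat -> vec k nat) t :
  linext (fun p => ocons (a p) (v p)) t = ocons (linform a t) (linext v t).
Proof.
rewrite /ocons linear_linext; last exact: linext_linear.
rewrite /linform /linext scaler_suml -big_split /=; apply: eq_bigr => p _.
by rewrite scalerDr scalerA.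
Qed.

Section Stack.
Variable T : choiceType.

Definition in_row n : vec k T -> vec k (nat * T)%type := linext (fun j => bvec k (n, j)).

HB.instance Definition _ n := GRing.Linear.on (in_row n).

Lemma linform_in_row h n v : linform h (in_row n v) = linform (fun j => h (n, j)) v.
Proof.
rewrite (scalar_linext _ _ (linform_scalar h)).
by apply: eq_linform => j; rewrite /= linform_bvec.
Qed.

Definition stack (b : nat -> nat -> vec k T) p : vec k (nat * T)%type :=
  \sum_(n < p.+1) in_row n (b n p).

Variable b : nat -> nat -> vec k T.
Hypothesis b0 : forall n p, (p < n)%N -> b n p = 0.

Lemma linext_stack t N : vanishes_from t N ->
  linext (stack b) t = \sum_(n < N) in_row n (linext (b n) t).
Proof.
move=> tN; rewrite (linext_ord _ tN).
under [RHS]eq_bigr => n _ do rewrite (linext_ord _ tN) linear_sum.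
rewrite [RHS]exchange_big; apply: eq_bigr => p _; rewrite scaler_sumr.
rewrite (big_ord_widen N (fun n => t p *: in_row n (b n p))) //.
rewrite big_mkcond; apply: eq_bigr => n _ /=; rewrite linearZ; case: ltnP => // pn.
by rewrite b0 // linear0 /= scaler0.
Qed.

Lemma linform_stack h t N : vanishes_from t N ->
  linform h (linext (stack b) t) =
  \sum_(n < N) linform (fun j => h (n : nat, j)) (linext (b n) t).
Proof.
move=> tN; rewrite (linext_stack tN).
under eq_bigr => n _ do rewrite -[in_row _ _]scale1r.
rewrite (scalar_sum _ _ _ (linform_scalar h)); apply: eq_bigr => n _.
by rewrite mul1r linform_in_row.
Qed.

Lemma stack_coord t n j : linext (stack b) t (n, j) = linext (b n) t j.
Proof.
have [N tN] := vec_nat_bound t.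
have tM : vanishes_from t (maxn N n.+1) by move=> p; rewrite geq_max => /andP[/tN].
have ltn : (n < maxn N n.+1)%N by rewrite leq_maxr.
rewrite -[linext (stack b) t]linext_id linextE (linform_stack _ tM).
rewrite (bigD1 (Ordinal ltn)) //= big1 ?addr0 => [|n' nn']; last first.
  rewrite linformE big1 // => p _; rewrite bvecE xpair_eqE eq_sym.
  by move: nn'; rewrite -val_eqE /= => /negPf->; rewrite mulr0.
rewrite -[in RHS](linext_id (linext (b n) t)) linextE.
by apply: eq_linform => p; rewrite /= !bvecE xpair_eqE eqxx.
Qed.

End Stack.

End Columns.

Section ProductDecomposition.
Variable k : fieldType.
Implicit Types (t : vec k nat) (H : nat -> nat -> k) (G : nat -> nat -> nat -> k).

Definition finite_rank_form H := exists d (l l' : nat -> nat -> k),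
  forall m p, H m p = \sum_(j < d) (l j m * l' j p + l' j m * l j p).

Lemma sum_nat_gt (F : nat -> k) n N :
  \sum_(0 <= p < N) (n < p)%N%:R * F p = \sum_(n.+1 <= p < N) F p.
Proof.
rewrite [RHS]big_geq_mkord [RHS]big_mkcond big_mkord; apply: eq_bigr => p _.
by case: (n < p)%N; rewrite ?mul1r ?mul0r.
Qed.

Definition from_diag n (a : k) (h : nat -> k) p : k :=
  (p == n)%:R * a + (n < p)%N%:R * h p.

Lemma linform_from_diag n a h t N : (n < N)%N -> vanishes_from t N ->
  linform (from_diag n a h) t = a * t n + \sum_(n.+1 <= p < N) h p * t p.
Proof.
move=> nN tN; rewrite (linform_nat _ tN) -sum_nat_gt.
have -> : a * t n = \sum_(0 <= p < N) a * t p * (p == n)%:R.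
  by rewrite big_mkord (sum_delta (Ordinal nN) (fun p => a * t p)).
by rewrite -big_split; apply: eq_bigr => p _; rewrite /from_diag /=; ring.
Qed.

Definition cut n H m p : k := (n < m)%N%:R * (n < p)%N%:R * H m p.

Lemma quad_products n H : (forall m p, H m p = H p m) ->
  exists b c : nat -> vec k nat, (forall p, (p <= n)%N -> b p = 0 /\ c p = 0) /\
    forall t, bilform (cut n H) t t = linform (linext c t) (linext b t).
Proof.
move=> Hsym; set C := cut n H; pose h m := from_diag m (C m m) (fun p => 2%:R * C m p).
have Cs m p : C m p = C p m by rewrite /C /cut Hsym; ring.
have C0 m p : (p <= n)%N -> C m p = 0.
  by rewrite leqNgt => /negPf pn; rewrite /C /cut pn mulr0 mul0r.
exists (fun p => if (p <= n)%N then 0 else bvec k p), (fun p => trunc_vec p.+1 (h^~ p)).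
split=> [p pn|t].
  rewrite pn; split=> //; apply/fsfunP => m; rewrite trunc_vecE vec0E /h /from_diag.
  have Cp q : C q p = 0 by exact: C0.
  by case: (eqVneq p m) => [<-|_]; rewrite !Cp !mulr0 ?mul0r addr0 mulr0.
have [N tN] := vec_nat_bound t.
rewrite (bilform_nat _ tN) (sum_symmetric2 (F := fun i j => C i j * t i * t j)); last first.
  by move=> i j; rewrite Cs; ring.
rewrite (scalar_linext _ _ (linform_scalar _)) (linform_nat _ tN).
apply: eq_big_nat => m /andP[_ mN] /=; case: ifP => [mn|_].
  have Cm p : C m p = 0 by rewrite Cs C0.
  rewrite Cm !mul0r big1 => [|p _]; last by rewrite Cm !mul0r.
  by rewrite (scalar0 (linform_scalar _)) !mulr0 addr0.
rewrite linform_bvec linextE (@eq_linform _ _ _ (h m)) => [|p /=]; last first.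
  by rewrite trunc_vecE ltnS /h /from_diag; case: (ltngtP m p); rewrite ?mul1r ?mul0r ?addr0.
rewrite (linform_from_diag _ _ mN tN) mulrDr !mulr_sumr; congr (_ + _); first by ring.
by apply: eq_bigr => p _; ring.
Qed.

Lemma quad_products_finite n H : finite_rank_form H ->
  exists d (b c : nat -> vec k nat), [/\ forall p, (p <= n)%N -> b p = 0 /\ c p = 0,
    forall p m, (d <= m)%N -> b p m = 0
    & forall t, bilform (cut n H) t t = linform (linext c t) (linext b t)].
Proof.
move=> [d [l [l' HE]]]; pose tail (h : nat -> nat -> k) j p := (n < p)%N%:R * h j p.
exists d, (fun p => trunc_vec d ((tail l)^~ p)),
  (fun p => trunc_vec d (fun j => 2%:R * tail l' j p)); split=> [p pn|p m dm|t].
- split; apply/fsfunP => m;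
    by rewrite trunc_vecE vec0E /tail [(n < p)%N]ltnNge pn !(mul0r, mulr0).
- by rewrite trunc_vecE ltnNge dm mul0r.
transitivity (\sum_(j < d) 2%:R * (linform (tail l j) t * linform (tail l' j) t)).
  transitivity (bilform (fun m p =>
      \sum_(j < d) (tail l j m * tail l' j p + tail l' j m * tail l j p)) t t).
    apply: eq_linform => m; apply: eq_linform => p; rewrite /cut HE mulr_sumr.
    by apply: eq_bigr => j _; rewrite /tail; ring.
  by rewrite bilform_products; apply: eq_bigr => j _; ring.
rewrite (@linform_nat _ _ _ d) => [|m dm]; last by rewrite linext_trunc_vec ltnNge dm mul0r.
rewrite big_mkord; apply: eq_bigr => j _; rewrite !linext_trunc_vec ltn_ord !mul1r.
by rewrite linformZ mulrCA.
Qed.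

Definition cubic_row G n t :=
  t n * linform (from_diag n (G n n n) (fun p => 3%:R * G n n p)) t
  + 3%:R * bilform (cut n (G n)) t t.

Lemma triform_rows G t N : symmetric3 G -> vanishes_from t N ->
  triform G t t t = \sum_(n < N) t n * cubic_row G n t.
Proof.
move=> [G12 G23] tN; rewrite (triform_nat _ tN).
rewrite (sum_symmetric3 (F := fun i j l => G i j l * t i * t j * t l)); last first.
  by split=> i j l; [rewrite G12 | rewrite G23]; ring.
rewrite big_mkord; apply: eq_bigr => n _.
rewrite /cubic_row (linform_from_diag _ _ (ltn_ord n) tN) (bilform_nat _ tN) !mulrDr.
congr (_ + _ + _).
- by ring.
- by rewrite !mulr_sumr; apply: eq_bigr => p _; ring.
rewrite -sum_nat_gt !mulr_sumr; apply: eq_bigr => m _.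
by rewrite -sum_nat_gt !mulr_sumr; apply: eq_bigr => p _; rewrite /cut; ring.
Qed.

(* For n outside al, the variable t_n is replaced by the forms x, which agree with it
   on the support of b but are locally finite. *)
Lemma cubic_row_products (al : bool) G n :
  (forall m p, G n m p = G n p m) -> (~~ al -> finite_rank_form (G n)) ->
  exists x b c : nat -> vec k (option nat),
    (forall p, (p < n)%N -> [/\ x p = 0, b p = 0 & c p = 0]) /\
    forall t, t n * cubic_row G n t =
      linform (fun m => (if al then t n else linext x t m) * linext c t m) (linext b t).
Proof.
move=> Gs Gfin; pose h := from_diag n (G n n n) (fun p => 3%:R * G n n p).
have [u [b [c [bc0 GE bu]]]] : exists (u : vec k nat) (b c : nat -> vec k nat),
    [/\ forall p, (p <= n)%N -> b p = 0 /\ c p = 0,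
      forall t, bilform (cut n (G n)) t t = linform (linext c t) (linext b t)
      & ~~ al -> forall p m, u m != 1 -> b p m = 0].
  have [al_n|/Gfin Gn] := boolP al.
    by have [b [c [bc0 GE]]] := quad_products n Gs; exists 0, b, c.
  have [d [b [c [bc0 bd GE]]]] := quad_products_finite n Gn.
  exists (trunc_vec d (fun=> 1)), b, c; split=> // _ p m; rewrite trunc_vecE mulr1.
  by case: ltnP => [_|/bd->//]; rewrite eqxx.
exists (fun p => (p == n)%:R *: ocons 1 u), (fun p => ocons (p == n)%:R (b p)),
  (fun p => ocons (h p) (3%:R *: c p)); split=> [p pn|t].
  have [-> ->] := bc0 p (ltnW pn).
  rewrite /h /from_diag (ltn_eqF pn) ltnNge (ltnW pn) !mul0r addr0 scale0r scaler0.
  by rewrite /ocons scale0r linear0 addr0.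
have delta_t : linform (fun p => (p == n)%:R) t = t n.
  by rewrite -[t in RHS]linext_id linextE; apply: eq_linform => p; rewrite bvecE eq_sym.
have xE : linext (fun p => (p == n)%:R *: ocons 1 u) t = t n *: ocons 1 u.
  by rewrite -delta_t /linform /linext scaler_suml; apply: eq_bigr => p _; rewrite scalerA.
have cE m : linext (fun p => 3%:R *: c p) t m = 3%:R * linext c t m.
  by rewrite !linextE -linformZ; apply: eq_linform => p; rewrite vecZE.
rewrite xE !linext_ocons linform_ocons delta_t ocons_None vecZE ocons_None mulr1 if_same.
rewrite /cubic_row GE mulrDr; congr (_ + _); rewrite -!linformZ.
apply: (@eq_linext _ _ k^o) => m; rewrite mem_finsupp /= vecZE !ocons_Some cE => bm.
case: ifP => [_|/negbT al_n]; first by ring.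
suff -> : u m = 1 by ring.
apply/eqP/negPn/negP => um; case/negP: bm; rewrite linextE linformE big1 // => p _.
by rewrite bu ?mulr0.
Qed.

Lemma cubic_products (al : pred nat) G :
  symmetric3 G -> (forall n, ~~ al n -> finite_rank_form (G n)) ->
  exists x b c : nat -> vec k (nat * option nat)%type, forall t, triform G t t t =
    linform (fun w => (if al w.1 then t w.1 else linext x t w) * linext c t w) (linext b t).
Proof.
move=> sG Gfin.
have /choice[x /choice[b /choice[c rowE]]] := fun n => cubic_row_products (sG.2 n) (Gfin n).
have x0 n p : (p < n)%N -> x n p = 0 by case/(rowE n).1.
have b0 n p : (p < n)%N -> b n p = 0 by case/(rowE n).1.
have c0 n p : (p < n)%N -> c n p = 0 by case/(rowE n).1.
exists (stack x), (stack b), (stack c) => t; have [N tN] := vec_nat_bound t.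
rewrite (triform_rows sG tN) (linform_stack b0 _ tN); apply: eq_bigr => n _.
by rewrite (rowE n).2; apply: eq_linform => m; rewrite /= !stack_coord.
Qed.

End ProductDecomposition.

(** * Realizing a countable family of coefficients *)

Section Realization.
Variables (k : closedFieldType) (V : lmodType k) (B : V -> V -> V -> k).
Hypotheses (tB : symmetric_trilinear B).
Hypotheses (two_neq0 : 2%:R != 0 :> k) (three_neq0 : 3%:R != 0 :> k).
Implicit Type G : nat -> nat -> nat -> k.
Local Notation K := (residual_kernel B).

Lemma realize_in_product_model al A X Y Z G : product_model (T := option nat) B al A X Y Z ->
  (forall n, ~~ al n -> A n = 0) -> symmetric3 G ->
  (forall n, ~~ al n -> finite_rank_form (G n)) ->
  exists v : nat -> V, forall i j l, B (v i) (v j) (v l) = G i j l.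
Proof.
move=> model A0 sG Gfin; pose F i j l := B (A i) (A j) (A l).
have sF : symmetric3 F by exact: symmetric3_tri.
have sGF : symmetric3 (fun i j l => G i j l - F i j l).
  by split=> i j l; [rewrite sG.1 sF.1 | rewrite sG.2 sF.2].
have [|x [b [c GFE]]] := @cubic_products k al _ sGF.
  move=> n al_n; have [d [l [l' GE]]] := Gfin n al_n; exists d, l, l' => m p.
  by rewrite /F A0 // (scalar0 (tri_scalar1 tB _ _)) subr0.
pose v p := A p + (linext X (x p) + linext Y (b p) + linext Z (c p)).
have vE t : linext v t =
    linext A t + (linext X (linext x t) + linext Y (linext b t) + linext Z (linext c t)).
  by rewrite !linextD !(linear_linext _ _ (linext_linear _)).
exists v => i j l.
rewrite -(triform_bvec G) -(triform_bvec (fun i j l => B (v i) (v j) (v l))).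
have sv := symmetric3_tri v tB.
apply: (eq_symmetric_trilinear (triform_symmetric sv) (triform_symmetric sG)
  (natr6_neq0 two_neq0 three_neq0)) => t.
by rewrite -tri_linext // vE model tri_linext // -GFE triform_subr addrC subrK.
Qed.

Hypothesis nondeg : ~ vanishes_cofinitely (fun v => B v v v).

Lemma realize_infinite G : infinite_codim K -> symmetric3 G ->
  exists v : nat -> V, forall i j l, B (v i) (v j) (v l) = G i j l.
Proof.
move=> infK sG.
have [A [E model]] := power_model_infinite tB two_neq0 three_neq0 nondeg
  (@code_weight k) infK code_head_leq.
have [X [Y [Z pmodel]]] := product_model_of_power two_neq0 three_neq0 (option nat) model.
by apply: realize_in_product_model pmodel _ sG _.
Qed.

Lemma realize_finite (xs : seq V) G :
  independent_mod K xs -> finite_codim K -> symmetric3 G ->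
  (forall n, (size xs <= n)%N -> finite_rank_form (G n)) ->
  exists v : nat -> V, forall i j l, B (v i) (v j) (v l) = G i j l.
Proof.
move=> ixs cK sG Gfin.
have [E model] := power_model_finite tB two_neq0 nondeg
  (@code_weight k) ixs cK code_head_leq.
have [X [Y [Z pmodel]]] := product_model_of_power two_neq0 three_neq0 (option nat) model.
apply: realize_in_product_model pmodel _ sG _ => n; rewrite -leqNgt => xsn.
  exact: nth_default.
exact: Gfin.
Qed.

End Realization.

(** * Formal polynomials and their polarizations *)

Section Monomials.
Variables (k : fieldType) (I : choiceType).
Implicit Types (f g h q : fpoly k I) (m : mono I) (a b c i j l : I) (s : seq I).

Definition mono_of s : mono I := seq_mset s.

Lemma eq_mono_of s s' : perm_eq s s' -> mono_of s = mono_of s'.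
Proof. by move/eq_seq_msetP. Qed.

Lemma mono_of_enum m : mono_of (enum_mset m) = m.
Proof. exact: seq_mset_id. Qed.

Lemma perm_enum_mono_of s : perm_eq (enum_mset (mono_of s)) s.
Proof. exact: perm_eq_seq_mset. Qed.

Lemma mdeg_mono_of s : mdeg (mono_of s) = size s.
Proof. exact/perm_size/perm_enum_mono_of. Qed.

Lemma mono_of1_inj : injective (fun a => mono_of [:: a]).
Proof.
move=> a b /eq_seq_msetP/perm_mem/(_ a); rewrite !inE eqxx.
by move/esym/eqP.
Qed.

Lemma enum_mono_of1 a : enum_mset (mono_of [:: a]) = [:: a] :> seq I.
Proof. exact: perm_small_eq (perm_enum_mono_of _). Qed.

Lemma perm_eq_pair a b i j : perm_eq [:: i; j] [:: a; b] ->
  (i = a /\ j = b) \/ (i = b /\ j = a).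
Proof.
move=> p; have /perm_mem/(_ i) := p; rewrite !inE eqxx => /esym/orP[]/eqP E; subst i.
  by left; move: p; rewrite perm_cons => /(perm_small_eq (isT : (size [:: b] <= 1)%N))[].
right; have p' : perm_eq [:: a; b] [:: b; a] by rewrite (perm_catC [:: a] [:: b]).
have := perm_trans p p'.
by rewrite perm_cons => /(perm_small_eq (isT : (size [:: a] <= 1)%N))[->].
Qed.

Lemma symmetric3_perm (T : Type) (H : I -> I -> I -> T) a b c i j l :
  symmetric3 H -> perm_eq [:: i; j; l] [:: a; b; c] -> H i j l = H a b c.
Proof.
move=> [swap12 swap23] p; have /perm_mem/(_ i) := p; rewrite !inE eqxx => /esym.
have tailE x a' b' : perm_eq [:: x; j; l] [:: x; a'; b'] -> H x j l = H x a' b'.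
  by rewrite perm_cons => /perm_eq_pair[] [-> ->].
case/or3P=> /eqP E; subst i; first exact: tailE.
  rewrite [RHS]swap12; apply: tailE; apply: perm_trans p _.
  by rewrite (perm_catCA [:: a] [:: b] [:: c]).
rewrite [RHS]swap23 [RHS]swap12; apply: tailE; apply: perm_trans p _.
by rewrite (perm_catC [:: a; b] [:: c]).
Qed.

(* Coefficients of the polarizations, without the factors 1/2 and 1/6: these are
   the iterated formal derivatives. *)
Definition polar2 q a b : k := (a == b).+1%:R * q (mono_of [:: a; b]).
Definition polar3 f i a b : k := polar2 (dpart i f) a b.

Lemma polar2C q a b : polar2 q a b = polar2 q b a.
Proof.
rewrite /polar2 eq_sym; congr (_ * q _).
by apply: eq_mono_of; rewrite (perm_catC [:: a] [:: b]).
Qed.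

Lemma dpart_mono_of i f s :
  dpart i f (mono_of s) = (count_mem i s).+1%:R * f (mono_of (i :: s)).
Proof. by rewrite /dpart mset_seqE /mono_of mset_cons. Qed.

Lemma polar3E f i a b : polar3 f i a b =
  ((a == b).+1 * ((a == i) + (b == i)).+1)%N%:R * f (mono_of [:: i; a; b]).
Proof. by rewrite /polar3 /polar2 dpart_mono_of /= addn0 mulrA natrM. Qed.

Lemma polar3_symmetric f : symmetric3 (polar3 f).
Proof.
split=> i a b; last exact: polar2C.
rewrite !polar3E; congr (_%:R * f _); last first.
  by apply: eq_mono_of; rewrite (perm_catCA [:: i] [:: a] [:: b]).
rewrite (eq_sym i a) (eq_sym i b).
case: (eqVneq a i) => [->|ai]; first by rewrite (eq_sym i b).
case: (eqVneq b i) => [->|bi]; first by rewrite (eq_sym i a) (negPf ai).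
by rewrite (eq_sym b a) mul1n muln1.
Qed.

Lemma mem_submsets1 a m : (mono_of [:: a] \in submsets m) = (a \in enum_mset m).
Proof.
rewrite mem_undup; apply/mapP/idP => [[t _ /eq_seq_msetP/perm_mem/(_ a)]|am].
  by rewrite inE eqxx => /esym/mem_mask.
have /subseqP[t st ta] : subseq [:: a] (enum_mset m) by rewrite sub1seq.
have st' : size t == mdeg m by rewrite st.
by exists (Tuple st'); rewrite ?mem_enum //= -ta.
Qed.

Lemma mdeg1P m : mdeg m = 1%N -> exists a, m = mono_of [:: a].
Proof.
rewrite -{2}(mono_of_enum m) /mdeg; case: (enum_mset m) => [|a [|]] // _.
by exists a.
Qed.

Lemma mulp_mono_of g h s : homogp 1 g -> mulp g h (mono_of s) =
  \sum_(a <- undup s) g (mono_of [:: a]) * h (mono_of (rem a s)).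
Proof.
move=> hg; pose L := [seq mono_of [:: a] | a <- undup (enum_mset (mono_of s))].
transitivity (\sum_(m <- L) g m * h (msetB (mono_of s) m)).
  rewrite /mulp (bigID (mem L)) /= [X in _ + X]big1_seq ?addr0 => [|m /andP[mL ms]].
    rewrite -big_filter; apply: perm_big; apply: uniq_perm.
    - by rewrite filter_uniq // undup_uniq.
    - by rewrite map_inj_uniq ?undup_uniq //; exact: mono_of1_inj.
    move=> m; rewrite mem_filter andb_idr // => /mapP[a]; rewrite mem_undup => am ->.
    by rewrite mem_submsets1.
  have [->|/hg/mdeg1P[a mE]] := eqVneq (g m) 0; first by rewrite mul0r.
  case/negP: mL; rewrite mE; apply: (map_f (fun a => mono_of [:: a])).
  by rewrite mem_undup -mem_submsets1 -mE.
rewrite /L big_map (perm_big (undup s)); last first.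
  by apply: perm_undup; exact: perm_mem (perm_enum_mono_of s).
apply: eq_big_seq => a; rewrite mem_undup => sa; congr (_ * h _).
by apply/msetP => b; rewrite msetE2 !mset_seqE count_rem sa /= addn0 eq_sym.
Qed.

Lemma polar2_mulp g h a b : homogp 1 g -> polar2 (mulp g h) a b =
  g (mono_of [:: a]) * h (mono_of [:: b]) + h (mono_of [:: a]) * g (mono_of [:: b]).
Proof.
move=> hg; rewrite /polar2 mulp_mono_of //= !inE; case: (eqVneq a b) => [->|ab].
  by rewrite big_seq1 /= eqxx; ring.
by rewrite big_cons big_seq1 /= !eqxx (negPf ab); ring.
Qed.

Lemma polar3_mulp g h a b c : homogp 1 g -> polar3 (mulp g h) a b c =
  g (mono_of [:: a]) * polar2 h b c + g (mono_of [:: b]) * polar2 h a c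
  + g (mono_of [:: c]) * polar2 h a b.
Proof.
move=> hg; rewrite polar3E mulp_mono_of //= !inE /polar2.
have hC x y : h (mono_of [:: x; y]) = h (mono_of [:: y; x]).
  by congr h; apply: eq_mono_of; rewrite (perm_catC [:: x] [:: y]).
rewrite !(eq_sym b a) !(eq_sym c a).
have [ab|ab] := eqVneq a b; [subst b|]; have [ac|ac] := eqVneq a c; [subst c| |subst c|].
- by rewrite ?eqxx /= big_seq1 /= eqxx; ring.
- by rewrite ?(negPf ac) /= big_cons big_seq1 /= ?eqxx ?(negPf ac) (hC a c); ring.
- rewrite [b == a]eq_sym ?(negPf ab) /= big_cons big_seq1 /= ?eqxx ?(negPf ab).
  by rewrite (hC b a); ring.
have [bc|bc] := eqVneq b c; [subst c|].
  by rewrite big_cons big_seq1 /= ?eqxx ?(negPf ab); ring.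
by rewrite !big_cons big_nil /= ?eqxx ?(negPf ab) ?(negPf ac) ?(negPf bc); ring.
Qed.

Lemma homogp_mulp g h n : homogp 1 g -> homogp n h -> homogp n.+1 (mulp g h).
Proof.
move=> hg hh m; rewrite -{1 2}(mono_of_enum m) mulp_mono_of // mdeg_mono_of.
set s := enum_mset m => nz; apply/eqP/negPn/negP=> sn.
case/negP: nz; apply/eqP; apply: big1_seq => a /andP[_]; rewrite mem_undup => sa.
have [->|/hh] := eqVneq (h (mono_of (rem a s))) 0; first by rewrite mulr0.
rewrite mdeg_mono_of size_rem // => E; case/eqP: sn; rewrite -E.
by case: (s) sa.
Qed.

Lemma homogp_dpart i f n : homogp n.+1 f -> homogp n (dpart i f).
Proof.
move=> hf m; rewrite -{1 2}(mono_of_enum m) dpart_mono_of mulf_eq0 negb_or => /andP[_ /hf].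
by rewrite !mdeg_mono_of => -[].
Qed.

Lemma homogp_sum n d (q : 'I_d -> fpoly k I) : (forall r, homogp n (q r)) ->
  homogp n (fun m => \sum_(r < d) q r m).
Proof.
move=> hq m nz; apply/eqP/negPn/negP => mn; case/negP: nz; apply/eqP; apply: big1 => r _.
by have [//|/hq E] := eqVneq (q r m) 0; rewrite E eqxx in mn.
Qed.

Lemma eq_homogp n q q' : homogp n q -> homogp n q' ->
  (forall s, size s = n -> q (mono_of s) = q' (mono_of s)) -> q =1 q'.
Proof.
move=> hq hq' E m; have [mn|mn] := eqVneq (mdeg m) n.
  by rewrite -(mono_of_enum m); apply: E.
have [->|/hq E1] := eqVneq (q m) 0; last by rewrite E1 eqxx in mn.
by have [->|/hq' E1] := eqVneq (q' m) 0; last by rewrite E1 eqxx in mn.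
Qed.

End Monomials.

Section Strength.
Variables (k : fieldType) (I : choiceType).
Hypotheses (two_neq0 : 2%:R != 0 :> k) (three_neq0 : 3%:R != 0 :> k).
Implicit Types (f q : fpoly k I) (m : mono I) (a b c i : I).

Definition linear_fpoly (h : I -> k) : fpoly k I :=
  fun m => if enum_mset m is [:: a] then h a else 0.

Definition quadratic_fpoly (Q : I -> I -> k) : fpoly k I :=
  fun m => if enum_mset m is [:: a; b] then (a == b).+1%:R^-1 * Q a b else 0.

Lemma homogp_linear_fpoly h : homogp 1 (linear_fpoly h).
Proof.
by move=> m; rewrite /linear_fpoly /mdeg; case: (enum_mset m) => [|a [|]] //=; rewrite eqxx.
Qed.

Lemma homogp_quadratic_fpoly Q : homogp 2 (quadratic_fpoly Q).
Proof.
move=> m; rewrite /quadratic_fpoly /mdeg.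
by case: (enum_mset m) => [|a [|b []]] //=; rewrite eqxx.
Qed.

Lemma linear_fpolyE h a : linear_fpoly h (mono_of [:: a]) = h a.
Proof. by rewrite /linear_fpoly enum_mono_of1. Qed.

Let mult2_neq0 a b : (a == b).+1%:R != 0 :> k.
Proof. by case: (a == b); rewrite ?two_neq0 ?oner_neq0. Qed.

Lemma polar2_quadratic_fpoly Q a b :
  (forall a b, Q a b = Q b a) -> polar2 (quadratic_fpoly Q) a b = Q a b.
Proof.
move=> Qs; rewrite /polar2 /quadratic_fpoly; have := perm_enum_mono_of [:: a; b].
case E : (enum_mset _) => [|x [|y [|z r]]] p; try by have := perm_size p.
have [[-> ->]|[-> ->]] := perm_eq_pair p; first by rewrite mulVKf.
by rewrite (eq_sym b a) mulVKf.
Qed.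

Lemma eq_polar2 q q' : homogp 2 q -> homogp 2 q' ->
  (forall a b, polar2 q a b = polar2 q' a b) -> q =1 q'.
Proof.
move=> hq hq' E; apply: (eq_homogp hq hq') => -[|a [|b [|]]] // _.
exact: mulfI (mult2_neq0 a b) _ _ (E a b).
Qed.

Lemma eq_polar3 f f' : homogp 3 f -> homogp 3 f' ->
  (forall a b c, polar3 f a b c = polar3 f' a b c) -> f =1 f'.
Proof.
move=> hf hf' E; apply: (eq_homogp hf hf') => -[|a [|b [|c [|]]]] // _.
move: (E a b c); rewrite !polar3E; apply: mulfI.
by rewrite natrM mulf_neq0 //; case: (b == a); case: (c == a);
  rewrite ?two_neq0 ?three_neq0 ?oner_neq0.
Qed.

Lemma vanishes_of_finite_strength2 q :
  finite_strength 2 q -> vanishes_cofinitely (fun v => bilform (polar2 q) v v).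
Proof.
move=> [d [gs [hs [hgh qE]]]].
have hg j : homogp 1 (gs j).
  by have [[|[|x]] [y [xx _ hg _]]] := hgh j.
pose G j a := gs j (mono_of [:: a]); pose H j a := hs j (mono_of [:: a]).
exists (\bigcap_(j in [set` enum 'I_d]) [set v | linform (G j) v = 0]).
  by apply: finite_codim_bigcap => j _; apply: finite_codim_ker; apply: linform_scalar.
move=> v Gv.
transitivity (bilform (fun a b => \sum_(j < d) (G j a * H j b + H j a * G j b)) v v).
  apply: eq_linform => a; apply: eq_linform => b; rewrite /polar2 qE mulr_sumr.
  by apply: eq_bigr => j _; rewrite -polar2_mulp.
rewrite bilform_products big1 // => j _.
by rewrite (Gv j) ?mul0r ?mulr0 ?addr0 //= mem_enum.
Qed.

Lemma finite_strength2_of_vanishes q : homogp 2 q ->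
  vanishes_cofinitely (fun v => bilform (polar2 q) v v) -> finite_strength 2 q.
Proof.
move=> hq; have bq := bilform_symmetric (polar2C q).
case/(finite_rank_bilinear two_neq0 bq)=> d [l [l' [_ _ qE]]].
exists d, (fun j => linear_fpoly (fun a => l j (bvec k a))),
  (fun j => linear_fpoly (fun a => l' j (bvec k a))).
split=> [j|]; first by exists 1%N, 1%N; split=> //; apply: homogp_linear_fpoly.
apply: eq_polar2 => // [|a b].
  by apply: homogp_sum => j; apply: homogp_mulp; apply: homogp_linear_fpoly.
rewrite -bilform_bvec qE /polar2 mulr_sumr; apply: eq_bigr => j _.
by rewrite -[RHS]/(polar2 _ a b) polar2_mulp ?linear_fpolyE //; apply: homogp_linear_fpoly.
Qed.

Lemma finite_strength3_of_vanishes f : homogp 3 f ->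
  vanishes_cofinitely (fun v => triform (polar3 f) v v v) -> finite_strength 3 f.
Proof.
move=> hf; have tf := triform_symmetric (polar3_symmetric f).
case/(finite_rank_trilinear two_neq0 three_neq0 tf)=> d [l [Q [_ Qs fE]]].
exists d, (fun j => linear_fpoly (fun a => l j (bvec k a))),
  (fun j => quadratic_fpoly (fun a b => Q j (bvec k a) (bvec k b))).
split=> [j|].
  exists 1%N, 2%N; split=> //; first exact: homogp_linear_fpoly.
  exact: homogp_quadratic_fpoly.
apply: eq_polar3 => // [|a b c].
  apply: homogp_sum => j; apply: homogp_mulp; first exact: homogp_linear_fpoly.
  exact: homogp_quadratic_fpoly.
rewrite -triform_bvec fE [RHS]polar3E mulr_sumr; apply: eq_bigr => j _.
rewrite -[RHS]polar3E polar3_mulp ?linear_fpolyE; last exact: homogp_linear_fpoly.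
by rewrite !polar2_quadratic_fpoly.
Qed.

Lemma finite_strength_dpart f r (ix : 'I_r -> I) (c : 'I_r -> k) : homogp 3 f ->
  finite_strength 2 (fun m => \sum_(j < r) c j * dpart (ix j) f m) <->
  residual_kernel (triform (polar3 f)) (\sum_(j < r) c j *: bvec k (ix j)).
Proof.
move=> hf; pose q m := \sum_(j < r) c j * dpart (ix j) f m.
have hq : homogp 2 q.
  apply: homogp_sum => j m; rewrite mulf_eq0 negb_or => /andP[_].
  exact: homogp_dpart.
have qE v : bilform (polar2 q) v v =
    triform (polar3 f) (\sum_(j < r) c j *: bvec k (ix j)) v v.
  rewrite [RHS](scalar_sum _ _ _ (linform_scalar _)).
  under [RHS]eq_bigr => j _ do rewrite linform_bvec.
  rewrite -bilform_sum; apply: eq_linform => a; apply: eq_linform => b.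
  by rewrite /polar2 mulr_sumr; apply: eq_bigr => j _; rewrite mulrCA.
have <- : vanishes_cofinitely (fun v => bilform (polar2 q) v v) =
    residual_kernel (triform (polar3 f)) (\sum_(j < r) c j *: bvec k (ix j)).
  by congr vanishes_cofinitely; apply/funext.
by split; [exact: vanishes_of_finite_strength2 | exact: finite_strength2_of_vanishes].
Qed.

End Strength.

Section Evaluation.
Variables (k : fieldType) (I : choiceType).
Implicit Types (f : fpoly k I) (v : vec k I) (a b c i j l : I) (S : {fset I}).

(* The permanent of the 3 x 3 matrix of incidences counts the orderings of a
   monomial with the multiplicity that [polar3] attaches to it. *)
Lemma incidence_permanent a b c i j l :
  let P i j l := ((i == a) * (j == b) * (l == c) + (i == a) * (j == c) * (l == b)
    + (i == b) * (j == a) * (l == c) + (i == b) * (j == c) * (l == a)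
    + (i == c) * (j == a) * (l == b) + (i == c) * (j == b) * (l == a))%N in
  P i j l = (perm_eq [:: i; j; l] [:: a; b; c] * ((b == c).+1 * ((b == a) + (c == a)).+1))%N.
Proof.
move=> P; have sP : symmetric3 P by split=> x y z; rewrite /P; lia.
have Pabc : P a b c = ((b == c).+1 * ((b == a) + (c == a)).+1)%N.
  rewrite /P !eqxx (eq_sym c b) (eq_sym a b) (eq_sym a c).
  case: (eqVneq b c) => [bc|_]; last by case: (b == a); case: (c == a).
  by rewrite bc; case: (c == a).
case: (boolP (perm_eq _ _)) => p; first by rewrite (symmetric3_perm sP p) Pabc mul1n.
have P0 x y z : perm_eq [:: x; y; z] [:: a; b; c] ->
    ((i == x) * (j == y) * (l == z) = 0)%N.
  move=> q; case: eqP => // ix; case: eqP => // jy; case: eqP => // lz.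
  by case/negP: p; rewrite ix jy lz.
have acb : perm_eq [:: a; c; b] [:: a; b; c] by rewrite perm_cons (perm_catC [:: c] [:: b]).
have bac : perm_eq [:: b; a; c] [:: a; b; c] by rewrite (perm_catCA [:: b] [:: a] [:: c]).
have bca : perm_eq [:: b; c; a] [:: a; b; c] by rewrite (perm_catC [:: b; c] [:: a]).
have cab : perm_eq [:: c; a; b] [:: a; b; c] by rewrite (perm_catC [:: c] [:: a; b]).
have cba : perm_eq [:: c; b; a] [:: a; b; c].
  by apply: perm_trans bca; rewrite (perm_catCA [:: c] [:: b] [:: a]).
by rewrite /P !P0.
Qed.

Lemma sum_orderings S a b c : a \in S -> b \in S -> c \in S ->
  \sum_(i <- S) \sum_(j <- S) \sum_(l <- S)
    (perm_eq [:: i; j; l] [:: a; b; c] * ((b == c).+1 * ((b == a) + (c == a)).+1))%N%:R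
  = 6%:R :> k.
Proof.
move=> aS bS cS.
under eq_bigr => i _ do under eq_bigr => j _ do under eq_bigr => l _ do
  rewrite -incidence_permanent.
have one x : x \in S -> \sum_(i <- S) (i == x)%:R = 1 :> k.
  move=> xS; rewrite (big_fsetD1 x) //= eqxx big1_fset ?addr0 // => i.
  by rewrite !inE => /andP[/negPf-> _].
have prod_one x y z : x \in S -> y \in S -> z \in S -> \sum_(i <- S) \sum_(j <- S)
    \sum_(l <- S) ((i == x) * (j == y) * (l == z))%N%:R = 1 :> k.
  move=> xS yS zS; rewrite -[RHS](one x xS); apply: eq_bigr => i _.
  rewrite -[RHS]mulr1 -[X in _ = _ * X](one y yS) mulr_sumr; apply: eq_bigr => j _.
  rewrite -[RHS]mulr1 -[X in _ = _ * X](one z zS) mulr_sumr; apply: eq_bigr => l _.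
  by rewrite !natrM.
have splitD (P P' : I -> I -> I -> nat) :
    \sum_(i <- S) \sum_(j <- S) \sum_(l <- S) (P i j l + P' i j l)%N%:R =
    \sum_(i <- S) \sum_(j <- S) \sum_(l <- S) (P i j l)%:R
    + \sum_(i <- S) \sum_(j <- S) \sum_(l <- S) (P' i j l)%:R :> k.
  rewrite -big_split; apply: eq_bigr => i _; rewrite -big_split; apply: eq_bigr => j _.
  by rewrite -big_split; apply: eq_bigr => l _; rewrite natrD.
by rewrite !splitD !prod_one //; ring.
Qed.

Lemma triform_finsupp (F : I -> I -> I -> k) v (S := finsupp v) : triform F v v v =
  \sum_(i <- S) \sum_(j <- S) \sum_(l <- S) F i j l * (v i * v j * v l).
Proof.
rewrite /triform /bilform linformE; apply: eq_bigr => i _; rewrite linformE mulr_sumr.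
apply: eq_bigr => j _; rewrite linformE !mulr_sumr; apply: eq_bigr => l _; ring.
Qed.

Lemma evaln3 f v : 6%:R * evaln 3 f v = triform (polar3 f) v v v.
Proof.
pose S := finsupp v; pose H i j l := polar3 f i j l * (v i * v j * v l).
have sH : symmetric3 H.
  have [f12 f23] := polar3_symmetric f.
  by split=> i j l; rewrite /H; [rewrite f12 | rewrite f23]; ring.
pose Lm := undup [seq mono_of (map val (val t)) | t <- enum {: 3.-tuple S}].
have inL i j l : i \in S -> j \in S -> l \in S -> mono_of [:: i; j; l] \in Lm.
  move=> iS jS lS; rewrite mem_undup; apply/mapP.
  by exists [tuple [` iS]%fset; [` jS]%fset; [` lS]%fset]; rewrite ?mem_enum.
transitivity (\sum_(m <- Lm) \sum_(i <- S) \sum_(j <- S) \sum_(l <- S)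
    (m == mono_of [:: i; j; l])%:R * H i j l); last first.
  rewrite triform_finsupp exchange_big; apply: eq_big_seq => i iS /=.
  rewrite exchange_big; apply: eq_big_seq => j jS /=.
  rewrite exchange_big; apply: eq_big_seq => l lS /=.
  rewrite (bigD1_seq _ (inL i j l iS jS lS) (undup_uniq _)) /= eqxx mul1r big1 ?addr0 //.
  by move=> m /negPf->; rewrite mul0r.
rewrite /evaln mulr_sumr; apply: eq_big_seq => m; rewrite mem_undup.
case/mapP=> -[[|a' [|b' [|c' [|]]]] //= _] _ ->.
move: (valP a') (valP b') (valP c') => /=.
move: (val a') (val b') (val c') => a b c {a' b' c'} aS bS cS; rewrite -/(mono_of _).
rewrite (perm_big _ (perm_enum_mono_of _)) /= !big_cons big_nil mulr1.
rewrite -(sum_orderings aS bS cS) mulr_suml; apply: eq_bigr => i _.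
rewrite mulr_suml; apply: eq_bigr => j _; rewrite mulr_suml; apply: eq_bigr => l _.
have -> : (mono_of [:: a; b; c] == mono_of [:: i; j; l]) = perm_eq [:: i; j; l] [:: a; b; c].
  by rewrite perm_sym; apply/eqP/idP => [/eq_seq_msetP|/eq_mono_of].
case: (boolP (perm_eq _ _)) => [p|_]; last by rewrite !mul0r.
by rewrite (symmetric3_perm sH p) /H polar3E mul1n mul1r !mulrA.
Qed.

End Evaluation.

(** * Residual rank and embeddings *)

Section ResidualRank.
Variables (k : fieldType) (I : choiceType) (f : fpoly k I).
Hypotheses (two_neq0 : 2%:R != 0 :> k) (hf : homogp 3 f).
Local Notation B := (triform (polar3 f)).
Local Notation K := (residual_kernel B).

Let tB : symmetric_trilinear B := triform_symmetric (polar3_symmetric f).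

Lemma rrk_ge_bvec r : rrk_ge f r <->
  exists2 xs : seq I, size xs = r & independent_mod K [seq bvec k i | i <- xs].
Proof.
split=> [[ix ind]|[xs sz ind]].
  exists [tuple ix j | j < r]; first by rewrite size_tuple.
  move=> c; rewrite size_map size_tuple => Kc i ir.
  apply: (ind (fun j => c j) _ (Ordinal ir)); apply/finite_strength_dpart => //.
  congr K: Kc; apply: eq_bigr => j _; congr (_ *: _).
  by rewrite (nth_map (ix j)) ?size_tuple // -tnth_nth tnth_mktuple.
move/eqP: sz => sz; pose t := Tuple sz.
exists (tnth t) => c /finite_strength_dpart-/(_ two_neq0 hf) Kc j.
pose c' n := if insub n is Some j' then c j' else 0.
have c'E j' : c' (val j') = c j' by rewrite /c' valK.
rewrite -c'E; apply: ind; last by rewrite size_map (eqP sz); exact: ltn_ord.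
rewrite size_map (eqP sz) (_ : \sum_(j < r) _ = \sum_(j < r) c j *: bvec k (tnth t j)) //.
apply: eq_bigr => l _.
by rewrite c'E (nth_map (tnth t l)) ?(eqP sz) // -(tnth_nth _ t).
Qed.

Lemma rrk_ge_independent D s : independent_mod K D -> (s <= size D)%N -> rrk_ge f s.
Proof.
move=> iD; elim: s => [_|s IH sD].
  by apply/rrk_ge_bvec; exists [::] => //; apply: independent_mod_nil.
have /rrk_ge_bvec[xs szx ixs] := IH (ltnW sD); apply/rrk_ge_bvec.
pose xv := [seq bvec k i | i <- xs].
have [i xi] : exists i, ~ span_mod K xv (bvec k i).
  apply: contrapT => /forallNP xsV.
  suff : (size D <= size xv)%N by rewrite size_map szx leqNgt sD.
  apply: (independent_mod_leq (residual_kernel_subspace tB)) => // v _.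
  rewrite -[v]linext_id; apply: (subspace_lincomb _ (lspan_subspace _)) => i _.
  exact: contrapT (xsV i).
exists (rcons xs i); first by rewrite size_rcons szx.
by rewrite map_rcons; apply: independent_mod_rcons.
Qed.

Lemma rrk_geP r : rrk_ge f r <-> exists2 D, size D = r & independent_mod K D.
Proof.
split=> [/rrk_ge_bvec[xs szx ixs]|[D <- iD]]; last exact: rrk_ge_independent iD (leqnn _).
by exists ([seq bvec k i | i <- xs]); rewrite ?size_map.
Qed.

Lemma rrk_ge_leq r s : (s <= r)%N -> rrk_ge f r -> rrk_ge f s.
Proof. by move=> sr /rrk_geP[D szD iD]; apply: (rrk_ge_independent iD); rewrite szD. Qed.

Lemma rrk_infinite_codim : (forall r, rrk_ge f r) -> infinite_codim K.
Proof.
move=> frk D; apply: contrapT => /forallNP DV.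
have /rrk_geP[E szE iE] := frk (size D).+1.
suff : (size E <= size D)%N by rewrite szE ltnn.
apply: (independent_mod_leq (residual_kernel_subspace tB)) => // v _.
exact: contrapT (DV v).
Qed.

Lemma rrk_basis r : rrk_ge f r -> ~ rrk_ge f r.+1 ->
  exists D, [/\ size D = r, independent_mod K D & forall v, span_mod K D v].
Proof.
move=> /rrk_geP[D szD iD] rS; exists D; split=> // v; apply: contrapT => Dv; apply: rS.
apply/rrk_geP; exists (rcons D v); first by rewrite size_rcons szD.
exact: independent_mod_rcons.
Qed.

Lemma is_rrk_rrk : is_rrk f (rrk f).
Proof.
apply: (ClassicalEpsilon.epsilon_spec (inhabits None) (is_rrk f)).
have [frk|/existsNP[r fr]] := pselect (forall r, rrk_ge f r); first by exists None.
elim: r fr => [fr|r IH fr].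
  by case: fr; apply/rrk_geP; exists [::] => //; apply: independent_mod_nil.
have [frk|/IH//] := pselect (rrk_ge f r); by exists (Some r).
Qed.

End ResidualRank.

Lemma le_rrkP (k : fieldType) (I J : choiceType) (f : fpoly k I) (g : fpoly k J) :
  2%:R != 0 :> k -> homogp 3 f -> homogp 3 g ->
  le_ninf (rrk g) (rrk f) <-> forall r, rrk_ge g r -> rrk_ge f r.
Proof.
move=> two_neq0 hf hg; have := is_rrk_rrk two_neq0 hf; have := is_rrk_rrk two_neq0 hg.
case: (rrk g) => [s|] /=; case: (rrk f) => [r|] /=; last by split.
- move=> [gs gS] [fr fS]; split=> [sr d gd|gf].
    apply: (rrk_ge_leq two_neq0 hf) fr; apply: leq_trans sr; rewrite leqNgt.
    by apply/negP => sd; apply: gS; apply: rrk_ge_leq sd gd.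
  rewrite leqNgt; apply/negP => rs; apply: fS.
  by apply: (rrk_ge_leq two_neq0 hf rs); apply: gf.
- by move=> _ frk; split.
- by move=> grk [_ fS]; split=> // gf; case: fS; apply: gf.
Qed.

Section Embedding.
Variables (k : fieldType) (I J : choiceType) (f : fpoly k I) (g : fpoly k J).
Hypotheses (two_neq0 : 2%:R != 0 :> k) (three_neq0 : 3%:R != 0 :> k).
Local Notation Bf := (triform (polar3 f)).
Local Notation Bg := (triform (polar3 g)).

Let six_neq0 : 6%:R != 0 :> k := natr6_neq0 two_neq0 three_neq0.

Let tf : symmetric_trilinear Bf := triform_symmetric (polar3_symmetric f).
Let tg : symmetric_trilinear Bg := triform_symmetric (polar3_symmetric g).

Lemma cubic_embeds_triform : cubic_embeds g f -> exists2 phi : vec k J -> vec k I,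
  linear phi & forall u v w, Bf (phi u) (phi v) (phi w) = Bg u v w.
Proof.
move=> [phi [phi_coord phi_eval]]; have phi_lin : linear phi.
  by move=> a u v; apply/fsfunP => i; rewrite -vlincomb_lmod phi_coord vecDE vecZE.
exists phi => //.
apply: (eq_symmetric_trilinear (symmetric_trilinear_comp phi_lin tf) tg six_neq0) => v.
by rewrite -!evaln3 phi_eval.
Qed.

Lemma embeds_rrk_ge r : homogp 3 f -> homogp 3 g ->
  cubic_embeds g f -> rrk_ge g r -> rrk_ge f r.
Proof.
move=> hf hg /cubic_embeds_triform[phi phi_lin phiB] /rrk_geP-/(_ two_neq0 hg)[D <- iD].
apply/rrk_geP => //; exists (map phi D); first exact: size_map.
move=> c; rewrite size_map => -[U cU U0] i iD'; apply: (iD c) iD'.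
exists (phi @^-1` U); first exact: finite_codim_preimage.
move=> v /U0 <-; rewrite -phiB; congr (Bf _ _ _).
by rewrite (linear_lincomb _ _ _ phi_lin); apply: eq_bigr => j _; rewrite (nth_map 0).
Qed.

Lemma embeds_of_generators (ws : nat -> vec k J) (v : nat -> vec k I) :
  (forall j, lspan (range ws) (bvec k j)) ->
  (forall n m p, Bf (v n) (v m) (v p) = Bg (ws n) (ws m) (ws p)) -> cubic_embeds g f.
Proof.
move=> wsV vE; have /choice[u uE] j := lspan_linext (wsV j).
pose x j := linext v (u j); exists (linext x); split=> [a w w' i|w].
  by rewrite vlincomb_lmod linearP vecDE vecZE.
apply: (mulfI six_neq0); rewrite !evaln3 tri_linext //; congr triform.
apply/funext => i; apply/funext => j; apply/funext => l.
rewrite -[RHS]triform_bvec !uE !tri_linext //; congr triform.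
by apply/funext => n; apply/funext => m; apply/funext => p.
Qed.

End Embedding.

Section CountableEmbedding.
Variables (k : closedFieldType) (I : choiceType) (J : countType).
Variables (f : fpoly k I) (g : fpoly k J).
Hypotheses (two_neq0 : 2%:R != 0 :> k) (three_neq0 : 3%:R != 0 :> k).
Hypotheses (hf : homogp 3 f) (nondeg : cubic_nondeg f).
Local Notation Bf := (triform (polar3 f)).
Local Notation Bg := (triform (polar3 g)).

Let tf : symmetric_trilinear Bf := triform_symmetric (polar3_symmetric f).
Let tg : symmetric_trilinear Bg := triform_symmetric (polar3_symmetric g).

Let nonvanishing : ~ vanishes_cofinitely (fun v => Bf v v v).
Proof. by move/(finite_strength3_of_vanishes two_neq0 three_neq0 hf). Qed.

Lemma embeds_infinite : (forall r, rrk_ge f r) -> cubic_embeds g f.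
Proof.
move=> /(rrk_infinite_codim two_neq0 hf) infK.
pose ws n := if @choice.unpickle J n is Some j then bvec k j else 0.
have [v vE] := realize_infinite tf two_neq0 three_neq0 nonvanishing infK
  (symmetric3_tri ws tg).
apply: (embeds_of_generators two_neq0 three_neq0 _ vE) => j; apply: mem_lspan.
by exists (choice.pickle j) => //; rewrite /ws choice.pickleK.
Qed.

Lemma embeds_finite D E :
  independent_mod (residual_kernel Bf) D -> (forall v, span_mod (residual_kernel Bf) D v) ->
  (forall w, span_mod (residual_kernel Bg) E w) -> (size E <= size D)%N -> cubic_embeds g f.
Proof.
move=> iD DV EW ED; have sKg := residual_kernel_subspace tg.
have /choice[c cE] j := span_mod_coord sKg (EW (bvec k j)).
pose rest j := bvec k j - \sum_(i < size E) c j i *: E`_i.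
pose ws n := if (n < size D)%N then E`_n else
  if @choice.unpickle J (n - size D) is Some j then rest j else 0.
have wsE i : (i < size E)%N -> ws i = E`_i by move=> iE; rewrite /ws (leq_trans iE).
have wsK n : (size D <= n)%N -> residual_kernel Bg (ws n).
  rewrite /ws ltnNge => -> /=; case: (choice.unpickle _) => [j|]; last exact: sKg.1.
  exact: cE.
have cKf := finite_codim_basis (residual_kernel_subspace tf) iD DV.
have [|v vE] := realize_finite tf two_neq0 three_neq0 nonvanishing iD cKf
    (symmetric3_tri ws tg).
  move=> n /wsK Kn.
  have [d [l [l' [_ _ BE]]]] :=
    finite_rank_bilinear two_neq0 (symmetric_bilinear_tri tg _) Kn.
  by exists d, (fun j m => l j (ws m)), (fun j m => l' j (ws m)) => m p; rewrite BE.
apply: (embeds_of_generators two_neq0 three_neq0 _ vE) => j.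
have sS := lspan_subspace (range ws).
have ws_in n : lspan (range ws) (ws n) by apply: mem_lspan; exists n.
rewrite -(subrK (\sum_(i < size E) c j i *: E`_i) (bvec k j)); apply: (subspaceD sS).
  have -> : bvec k j - \sum_(i < size E) c j i *: E`_i = ws (size D + choice.pickle j)%N.
    by rewrite /ws ltnNge leq_addr /= addKn choice.pickleK.
  exact: ws_in.
by apply: (subspace_lincomb _ sS) => i _; rewrite -wsE.
Qed.

End CountableEmbedding.

Theorem theorem1p1 (k : closedFieldType)
  (hk2 : 2%N \notin [pchar k]) (hk3 : 3%N \notin [pchar k])
  (I : choiceType) (f : fpoly k I) (hf : homogp 3 f) (hnd : cubic_nondeg f)
  (J : countType) (g : fpoly k J) (hg : homogp 3 g) :
  cubic_embeds g f <-> le_ninf (rrk g) (rrk f).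
Proof.
have two_neq0 : 2%:R != 0 :> k by move: hk2; rewrite inE.
have three_neq0 : 3%:R != 0 :> k by move: hk3; rewrite inE.
split=> [emb|le_gf]; first by apply/le_rrkP => // r; apply: embeds_rrk_ge.
case: (rrk f) le_gf (is_rrk_rrk two_neq0 hf) => [r|] /=; last first.
  by move=> _ fr; apply: embeds_infinite.
case: (rrk g) (is_rrk_rrk two_neq0 hg) => [s|] //= [gs gS] sr [fr fS].
have [D [szD iD DV]] := rrk_basis two_neq0 hf fr fS.
have [E [szE _ EW]] := rrk_basis two_neq0 hg gs gS.
by apply: (embeds_finite two_neq0 three_neq0 hf hnd iD DV EW); rewrite szD szE.
Qed.
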